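(* Assume $-y\ge r/(4c)$. Then the value function $U$ of the hitting time game is the unique viscosity solution on $[0,D]$ (in the sense defined in the context) of the Bellman equation $$\max\Big\{-\frac{1}{4c}(f'(x))^2-y f'(x)-h(x),\ f'(x)-r\Big\}=0 .$$
   Context: Fixed data: constants $D>0$, $r>0$, $c_1>0$, $c_2>0$, $y\in\mathbb{R}$; $c:=(c_1^{-1}+c_2^{-1})^{-1}$; and a continuous, strictly increasing function $h:[0,D]\to[0,\infty)$ with $h(0)=0$. Let $\mathcal{P}$ be the set of continuous functions $[0,\infty)\to\mathbb{R}$ starting at $0$, and $\mathcal{E}$ the set of nondecreasing right-continuous functions with left limits $[0,\infty)\to[0,\infty)$ (a positive value at time $0$ is allowed and is regarded as a jump at time $0$). For $T\ge0$ and $\psi=(\psi^1,\psi^2)\in\mathcal{P}^2$ let $\mathbb{I}(T,\psi)=\int_0^T\big[c_1(\dot\psi^1(s))^2+c_2(\dot\psi^2(s))^2\big]ds$ if $\psi^1,\psi^2$ are absolutely continuous on $[0,T]$, and $\mathbb{I}(T,\psi)=+\infty$ otherwise. Hitting time game. Given $x\in[0,D]$, $\psi\in\mathcal{P}^2$, $\varrho\in\mathcal{E}$, the dynamics are $\varphi_{x,\psi,\varrho}(t)=x+yt+\psi^1(t)-\psi^2(t)-\varrho(t)$, $t\ge0$, and $\tau(x,\psi,\varrho)=\inf\{t\ge0:\varphi_{x,\psi,\varrho}(t)=0\}$ ($\inf\emptyset=\infty$). A strategy is a map $\bar\alpha:\mathcal{P}^2\to\mathcal{E}$ that is causal: for every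 $t\ge0$, if $\psi=\tilde\psi$ on $[0,t]$ then $\bar\alpha[\psi]=\bar\alpha[\tilde\psi]$ on $[0,t]$. Let $\bar{\mathcal{A}}_x$ be the set of strategies such that for every $\psi\in\mathcal{P}^2$, with $\varrho=\bar\alpha[\psi]$, one has $\varphi_{x,\psi,\varrho}(t)\in[0,D]$ for all finite $t\in[0,\tau(x,\psi,\varrho)]$. Let $\mathcal{Q}[x,\bar\alpha]=\{\psi\in\mathcal{P}^2:\tau(x,\psi,\bar\alpha[\psi])<\infty\}$. For $\psi\in\mathcal{Q}[x,\bar\alpha]$ set, with $\tau=\tau(x,\psi,\bar\alpha[\psi])$ and $\varphi=\varphi_{x,\psi,\bar\alpha[\psi]}$, $$\bar c(x,\psi,\bar\alpha[\psi])=\int_0^\tau h(\varphi(t))\,dt+r\,\bar\alpha[\psi](\tau)-\mathbb{I}(\tau,\psi),\qquad U(x)=\inf_{\bar\alpha\in\bar{\mathcal{A}}_x}\ \sup_{\psi\in\mathcal{Q}[x,\bar\alpha]}\bar c(x,\psi,\bar\alpha[\psi]).$$ Viscosity solutions. For $B=(0,D)$ or $B=(0,D]$, a continuous function $f:[0,D]\to\mathbb{R}$ is a viscosity supersolution (resp. subsolution) of the Bellman equation on $B$ if for every $x\in B$ and every $\phi\in C^1([0,D],\mathbb{R})$ for which $f-\phi$ has a global minimum (resp. maximum) on $B$ at $x$, one has $\max\{-\frac1{4c}(\phi'(x))^2-y\phi'(x)-h(x),\ \phi'(x)-r\}\ge0$ (resp. $\le0$). A function $f:[0,D]\to\mathbb{R}$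 is a viscosity solution on $[0,D]$ if it is a viscosity subsolution on $(0,D)$, a viscosity supersolution on $(0,D]$, and $f(0)=0$. *)

(* Defs.v *)
From HB Require Import structures.
From mathcomp Require Import all_boot all_order all_algebra.
From mathcomp Require Import all_classical all_reals all_analysis.

Set Implicit Arguments.
Unset Strict Implicit.
Unset Printing Implicit Defensive.

Import Order.TTheory GRing.Theory Num.Theory.
Import numFieldNormedType.Exports.

Local Open Scope classical_set_scope.
Local Open Scope ring_scope.

(* A function on [0, +oo[ or on [0, D] is represented by a total function on R
   whose values outside that interval are irrelevant. *)

Definition is_path (R : realType) (psi : R -> R) : Prop :=
  {within `[0, +oo[, continuous psi} /\ psi 0 = 0.

Definition path2 (R : realType) (psi : (R -> R) * (R -> R)) : Prop :=
  is_path psi.1 /\ is_path psi.2.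

Definition is_control (R : realType) (rho : R -> R) : Prop :=
  [/\ forall t : R, 0 <= t -> 0 <= rho t,
      forall s t : R, 0 <= s -> s <= t -> rho s <= rho t,
      forall t : R, 0 <= t -> rho s @[s --> t^'+] --> rho t
    & forall t : R, 0 < t -> cvg (rho s @[s --> t^'-])].

Definition abs_continuous (R : realType) (a b : R) (f : R -> R) : Prop :=
  forall e : R, 0 < e -> exists2 d : R, 0 < d &
    forall (n : nat) (u v : 'I_n -> R),
      (forall i, a <= u i /\ u i <= v i /\ v i <= b) ->
      (forall i j, i != j -> v i <= u j \/ v j <= u i) ->
      \sum_(i < n) (v i - u i) < d ->
      \sum_(i < n) `|f (v i) - f (u i)| < e.

(* [derive1] is total; an absolutely continuous function is derivable almost
   everywhere on [0, T], so the integral does not see the other points. *)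
Definition energy (R : realType) (c1 c2 : R) (T : R)
    (psi : (R -> R) * (R -> R)) : \bar R :=
  if `[< abs_continuous 0 T psi.1 /\ abs_continuous 0 T psi.2 >] then
    (\int[@lebesgue_measure R]_(s in `[0%R, T])
       (c1 * derive1 psi.1 s ^+ 2 + c2 * derive1 psi.2 s ^+ 2)%:E)%E
  else +oo%E.

Definition dynamics (R : realType) (y x : R) (psi : (R -> R) * (R -> R))
    (rho : R -> R) (t : R) : R :=
  x + y * t + psi.1 t - psi.2 t - rho t.

Definition hitting_time (R : realType) (y x : R) (psi : (R -> R) * (R -> R))
    (rho : R -> R) : \bar R :=
  ereal_inf [set t%:E | t in [set t | 0 <= t /\ dynamics y x psi rho t = 0]].

(* Causality makes [alpha psi] on [0, +oo[ independent of the values of [psi]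
   at negative times. *)
Definition strategy (R : realType)
    (alpha : (R -> R) * (R -> R) -> (R -> R)) : Prop :=
  (forall psi, path2 psi -> is_control (alpha psi)) /\
  (forall (t : R) psi psi', 0 <= t -> path2 psi -> path2 psi' ->
     (forall s, 0 <= s -> s <= t -> psi.1 s = psi'.1 s /\ psi.2 s = psi'.2 s) ->
     forall s, 0 <= s -> s <= t -> alpha psi s = alpha psi' s).

Definition admissible (R : realType) (D y x : R)
    (alpha : (R -> R) * (R -> R) -> (R -> R)) : Prop :=
  strategy alpha /\
  forall psi, path2 psi -> forall t : R, 0 <= t ->
    (t%:E <= hitting_time y x psi (alpha psi))%E ->
    0 <= dynamics y x psi (alpha psi) t <= D.

Definition finite_hitting (R : realType) (y x : R)
    (alpha : (R -> R) * (R -> R) -> (R -> R)) : set ((R -> R) * (R -> R)) :=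
  [set psi | path2 psi /\ (hitting_time y x psi (alpha psi) < +oo)%E].

Definition cost (R : realType) (r c1 c2 y : R) (h : R -> R) (x : R)
    (psi : (R -> R) * (R -> R)) (rho : R -> R) : \bar R :=
  let tau := fine (hitting_time y x psi rho) in
  (\int[@lebesgue_measure R]_(t in `[0%R, tau]) (h (dynamics y x psi rho t))%:E
   + (r * rho tau)%:E - energy c1 c2 tau psi)%E.

Definition game_value (R : realType) (D r c1 c2 y : R) (h : R -> R) (x : R)
    : \bar R :=
  ereal_inf [set ereal_sup [set cost r c1 c2 y h x psi (alpha psi)
                           | psi in finite_hitting y x alpha]
            | alpha in admissible D y x].

(* [phi] is C^1 on [0, D] with derivative [dphi], one-sided at 0 and D. *)
Definition C1_with_derivative (R : realType) (D : R) (phi dphi : R -> R)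
    : Prop :=
  {within `[0, D], continuous dphi} /\
  forall x : R, 0 <= x <= D ->
    (phi z - phi x) / (z - x) @[z --> within `[0, D] x^'] --> dphi x.

Definition bellman (R : realType) (r c y : R) (h : R -> R) (x p : R) : R :=
  Num.max (- (1 / (4 * c)) * p ^+ 2 - y * p - h x) (p - r).

Definition viscosity_supersolution (R : realType) (D r c y : R) (h : R -> R)
    (B : set R) (f : R -> R) : Prop :=
  {within `[0, D], continuous f} /\
  forall (x : R) (phi dphi : R -> R), B x -> C1_with_derivative D phi dphi ->
    (forall z, B z -> f x - phi x <= f z - phi z) ->
    0 <= bellman r c y h x (dphi x).

Definition viscosity_subsolution (R : realType) (D r c y : R) (h : R -> R)
    (B : set R) (f : R -> R) : Prop :=
  {within `[0, D], continuous f} /\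
  forall (x : R) (phi dphi : R -> R), B x -> C1_with_derivative D phi dphi ->
    (forall z, B z -> f z - phi z <= f x - phi x) ->
    bellman r c y h x (dphi x) <= 0.

Definition viscosity_solution (R : realType) (D r c y : R) (h : R -> R)
    (f : R -> R) : Prop :=
  [/\ viscosity_subsolution D r c y h `]0, D[ f,
      viscosity_supersolution D r c y h `]0, D] f
    & f 0 = 0].

(* Main.v *)
(* Write H(p) = - p^2 / (4 c) - y p. The assumption on y says H(r) >= 0, so where
   h <= H(r) the equation H(p) = h has a smallest root in [0, r]; let g be that
   root there, and r where h > H(r). As h increases, g is nondecreasing, and the
   candidate is the convex function V(x) = \int_0^x g; of V only the bounds
   g(s) (t - s) <= V(t) - V(s) <= g(t) (t - s) are ever used.

   Uniqueness. The increments of a subsolution f are controlled by its jets, which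
   satisfy p <= r and H(p) <= h. For a supersolution, if q < r and H(q) < h(a),
   then z |-> f(z) - q z cannot attain its minimum over [a, D] in ]a, D], at D
   either because the supersolution property holds there. Hence f grows on [a, D]
   at least with slope g(a).

   Upper bound for the game. Let xs be the last level with h <= H(r); the minimizer
   reflects the state at xs. No chain rule is needed. For every constant p, the
   energy spent on [s, t] is at least p (psi(t) - psi(s)) - p^2 (t - s) / (4 c),
   where psi = psi^1 - psi^2. Before the first visit to xs and after the last
   one use, on short intervals, the slope p of the chord of V; in between use
   p = r. This requires the fundamental theorem of calculus for absolutely continuous
   functions, obtained from the total variation, Radon-Nikodym and Lebesgue
   differentiation.

   Lower bound. If the maximizer holds a momentum p <= r until the state drops
   below l, the payoff increases by at least p per unit of drop plus
   (h(l) - H(p)) per unit of time. Below xs the choice p = g(l) drives the state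
   downwards and earns the increment of V up to an arbitrarily small error. Above
   xs the choice p = r earns a positive rate of payoff, so that either the state is
   pushed back to xs or the accumulated payoff allows the maximizer to give up. *)
Require Import Defs.
From HB Require Import structures.
From mathcomp Require Import all_boot all_order all_algebra.
From mathcomp Require Import all_classical all_reals all_analysis.
From mathcomp Require Import measurable_realfun ring lra.
Set Implicit Arguments.
Unset Strict Implicit.
Unset Printing Implicit Defensive.
Import Order.TTheory GRing.Theory Num.Theory.
Import numFieldNormedType.Exports.
Local Open Scope classical_set_scope.
Local Open Scope ring_scope.

(** * Continuity on a subset of the line and truncation to an interval *)

Section within_continuity.
Context {R : realType}.
Implicit Types (A : set R) (f : R -> R).

Lemma within_continuousP A f : {within A, continuous f} <->
  forall x, A x -> forall e, 0 < e -> exists2 d, 0 < d &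
    forall z, A z -> `|z - x| < d -> `|f z - f x| < e.
Proof.
split=> [/subspace_continuousP cf x Ax e e0|H].
  have /cvgrPdist_lt/(_ _ e0) := cf x Ax.
  rewrite near_withinE => /nbhs_ballP[d /= d0 H]; exists d => // z Az zx.
  by rewrite distrC; apply: H => //; rewrite /ball/= distrC.
apply/subspace_continuousP => x Ax; apply/cvgrPdist_lt => e e0.
have [d d0 Hd] := H x Ax e e0.
rewrite near_withinE; apply/nbhs_ballP; exists d => //= z xz Az.
by rewrite distrC; apply: Hd => //; rewrite distrC.
Qed.

(** Precomposition with [clamp a b] extends a function from [a, b] by constants and keeps continuity
    and monotonicity, so that results about functions on the whole line apply. *)
Definition clamp (a b x : R) := Num.min b (Num.max a x).

Lemma clamp_itv a b x : a <= b -> a <= clamp a b x <= b.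
Proof.
by move=> ab; rewrite /clamp le_min ab le_max lexx/= ge_min lexx.
Qed.

Lemma clamp_id a b x : a <= x <= b -> clamp a b x = x.
Proof. by move=> /andP[ax xb]; rewrite /clamp max_r// min_r. Qed.

Lemma clamp_homo a b : {homo clamp a b : x y / x <= y}.
Proof.
move=> x y xy; rewrite /clamp le_min ge_min lexx/= ge_min; apply/orP; right.
by rewrite ge_max !le_max lexx/= xy orbT.
Qed.

Lemma clamp_dist a b x y : `|clamp a b x - clamp a b y| <= `|x - y|.
Proof.
wlog xy : x y / x <= y.
  by move=> H; have [/H//|/ltW/H] := leP x y; rewrite distrC (distrC y).
rewrite distrC ger0_norm ?subr_ge0 ?clamp_homo// distrC ger0_norm ?subr_ge0//.
rewrite /clamp /Num.min /Num.max; do !case: ifP; lra.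
Qed.

Lemma clamp_continuous a b f : a <= b -> {within `[a, b], continuous f} ->
  continuous (f \o clamp a b).
Proof.
move=> ab /within_continuousP cf x; apply/cvgrPdist_lt => e e0.
have [|d d0 H] := cf (clamp a b x) _ e e0; first by rewrite /= in_itv/= clamp_itv.
apply/nbhs_ballP; exists d => //= z xz; rewrite distrC; apply: H.
  by rewrite /= in_itv/= clamp_itv.
by rewrite distrC; apply: le_lt_trans (clamp_dist _ _ _ _) _.
Qed.

End within_continuity.

(** * Induction along a real interval *)

Section real_induction.
Context {R : realType}.

(** One step from a nearby point on the left overshoots the supremum of the points satisfying [P],
    unless it is stopped by [b]. Allowing [s <= x <= t] merges the closedness and the openness
    argument into one hypothesis. *)
Lemma real_induction (a b : R) (P : R -> Prop) : a <= b -> P a ->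
  (forall x, a <= x <= b -> exists2 d, 0 < d & forall s t,
     a <= s -> x - d < s -> s <= x -> x <= t -> t < x + d -> t <= b ->
     P s -> P t) ->
  P b.
Proof.
move=> ab Pa H; pose S := [set t | a <= t <= b /\ P t].
have Sa : S a by split => //; rewrite lexx.
have uS : has_ubound S by exists b => t [/andP[]].
have aS : a <= sup S by apply: ub_le_sup.
have Sb : sup S <= b by apply: ge_sup; [exists a|move=> t [/andP[]]].
have [|d d0 {}H] := H (sup S); first by rewrite aS Sb.
have [s Ss ds] : exists2 s, S s & sup S - d < s.
  by apply: sup_gt; [exists a|rewrite ltrBlDr ltrDl].
have sS : s <= sup S by exact: ub_le_sup.
have [/andP[as_ _] Ps] := Ss.
pose t := Num.min b (sup S + d / 2).
have St : sup S <= t by rewrite le_min Sb lerDl divr_ge0// ltW.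
have tb : t <= b by rewrite ge_min lexx.
have Pt : P t.
  apply: (H s) => //; rewrite /t gt_min; apply/orP; right.
  by rewrite ltrD2l ltr_pdivrMr// ltr_pMr// ltr1n.
have tS : t <= sup S by apply: ub_le_sup => //; split; rewrite ?(le_trans aS St).
suff <- : t = b by [].
move: tS; rewrite /t /Num.min; case: ltP => // _; lra.
Qed.

(** A substitute for the sign test on derivatives. Only increments with one end at [x] are bounded;
    an interval around [x] is cut at [x]. *)
Lemma le_of_small_increments (a b : R) (F : R -> R) : a <= b ->
  (forall x e, a <= x <= b -> 0 < e -> exists2 d, 0 < d & forall s t,
     a <= s -> x - d < s -> s <= t -> t < x + d -> t <= b ->
     s = x \/ t = x -> F t - F s <= e * (t - s)) ->
  F b <= F a.
Proof.
move=> ab H; apply/ler_addgt0Pr => e e0.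
(* The [+ 1] keeps the denominator positive when [a = b]. *)
pose e' := e / (b - a + 1).
have ba0 : 0 < b - a + 1 by rewrite ltr_pwDr// subr_ge0.
have e'0 : 0 < e' by rewrite divr_gt0.
suff : F b - F a <= e' * (b - a).
  move=> /le_trans; rewrite -lerBlDl; apply; rewrite /e' mulrAC ler_pdivrMr//.
  by rewrite ler_pM2l// lerDl.
apply: (@real_induction a b (fun t => F t - F a <= e' * (t - a))) => //.
  by rewrite !subrr mulr0.
move=> x xab; have [d d0 Hd] := H x e' xab e'0; exists d => // s t as_ ds sx xt td tb Fs.
have /andP[ax xb] := xab.
have h1 := Hd s x as_ ds sx (_ : x < x + d) xb (or_intror erefl).
have h2 := Hd x t ax (_ : x - d < x) xt td tb (or_introl erefl).
have {}h1 : F x - F s <= e' * (x - s) by apply: h1; rewrite ltrDl.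
have {}h2 : F t - F x <= e' * (t - x) by apply: h2; rewrite ltrBlDr ltrDl.
by move: Fs h1 h2; rewrite !mulrBr; lra.
Qed.

End real_induction.

(** * Integrals over bounded intervals *)

Section itv_integrable.
Context {R : realType}.
Notation mu := (@lebesgue_measure R).
Implicit Types (a b k M : R) (f : R -> R).

Lemma lebesgue_itv_fine a b (x y : bool) : a <= b ->
  fine (mu [set` Interval (BSide x a) (BSide y b)]) = b - a.
Proof.
move=> ab; rewrite lebesgue_measure_itv/= lte_fin; case: ltgtP ab => //= -> _.
by rewrite subrr.
Qed.

Lemma bounded_itv_integrable a b (x y : bool) f M :
  let I := [set` Interval (BSide x a) (BSide y b)] in
  measurable_fun I f -> (forall t, I t -> `|f t| <= M) ->
  mu.-integrable I (EFin \o f).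
Proof.
move=> I mf fM; have muI : (mu I < +oo)%E.
  by rewrite lebesgue_measure_itv/=; case: ifP => _; rewrite ltry.
apply: measurable_bounded_integrable => //; first exact: measurable_itv.
exists M; split; first exact: num_real.
by move=> M' MM' t It /=; apply: le_trans (fM _ It) (ltW MM').
Qed.

Lemma cst_itv_integrable a b (x y : bool) k :
  mu.-integrable [set` Interval (BSide x a) (BSide y b)] (EFin \o cst k).
Proof. exact: (@bounded_itv_integrable _ _ _ _ _ `|k|). Qed.

Lemma Rintegral_itv_cst a b (x y : bool) k : a <= b ->
  \int[mu]_(t in [set` Interval (BSide x a) (BSide y b)]) k = k * (b - a).
Proof.
by move=> ab; rewrite Rintegral_cst ?lebesgue_itv_fine//; exact: measurable_itv.
Qed.

End itv_integrable.

(** * Absolutely continuous functions *)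

Section ac.
Context {R : realType}.
Implicit Types (a b : R) (f : R -> R) (s : seq (R * R)).

(** Lists, in contrast to the indexed families of [abs_continuous], allow an interval to be replaced
    by the pieces of a partition. *)
Definition nonoverlapping a b s :=
  all (fun p => [&& a <= p.1, p.1 <= p.2 & p.2 <= b]) s &&
  pairwise (fun p q => (p.2 <= q.1) || (q.2 <= p.1)) s.

(** The weak inequality in the conclusion survives a supremum over partitions. *)
Lemma abs_continuous_seq a b f e : abs_continuous a b f -> 0 < e ->
  exists2 d, 0 < d & forall s, nonoverlapping a b s ->
    \sum_(p <- s) (p.2 - p.1) < d -> \sum_(p <- s) `|f p.2 - f p.1| <= e.
Proof.
move=> acf e0; have [d d0 H] := acf _ e0; exists d => // s /andP[/allP sab ps].
rewrite !(big_nth (0, 0)) !big_mkord => sd; apply/ltW.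
apply: (H _ (fun i : 'I_(size s) => (nth (0, 0) s i).1)
            (fun i : 'I_(size s) => (nth (0, 0) s i).2)) => //.
- by move=> i; have /and3P[] := sab _ (mem_nth (0, 0) (ltn_ord i)).
- move=> i j ij; have := ij; rewrite -val_eqE neq_ltn => /orP[] ij'.
    by have /(pairwiseP (0,0))/(_ _ _ (ltn_ord i) (ltn_ord j) ij')/orP[] := ps; [left|right].
  by have /(pairwiseP (0,0))/(_ _ _ (ltn_ord j) (ltn_ord i) ij')/orP[] := ps; [right|left].
Qed.

(** Zipping [l] with [a :: l] pairs each partition point with its predecessor; the swap puts the
    left end first. *)
Definition pieces a (l : seq R) := [seq (p.2, p.1) | p <- zip l (a :: l)].

Lemma piecesE a b f l : itv_partition a b l ->
  variation a b f l = \sum_(p <- pieces a l) `|f p.2 - f p.1|.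
Proof. by move=> abl; rewrite variation_zip// big_map. Qed.

Lemma pieces_length a b l : itv_partition a b l ->
  \sum_(p <- pieces a l) (p.2 - p.1) = b - a.
Proof.
elim: l a => [a /itv_partition_nil ->|x l ih a]; first by rewrite big_nil subrr.
move=> /itv_partition_cons/ih xb; rewrite /pieces/= big_cons/= -/(pieces x l) xb.
by rewrite addrC addrA subrK.
Qed.

Lemma pieces_nonoverlapping a b l : itv_partition a b l ->
  nonoverlapping a b (pieces a l).
Proof.
elim: l a => [//|x l ih a abl].
have xbl := itv_partition_cons abl.
have xb := itv_partition_le xbl; have := ih _ xbl.
case: abl => /= /andP[/ltW ax _] _.
rewrite /nonoverlapping /pieces/= -/(pieces x l) lexx ax xb /= => /andP[h1 ->].
rewrite andbT; apply/andP; split.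
  by apply: sub_all h1 => p /and3P[xp -> ->]; rewrite (le_trans ax xp).
by apply: sub_all h1 => p /and3P[-> _ _].
Qed.

Lemma nonoverlapping_cat a b s1 s2 : nonoverlapping a b (s1 ++ s2) =
  [&& nonoverlapping a b s1, nonoverlapping a b s2 &
      allrel (fun p q => (p.2 <= q.1) || (q.2 <= p.1)) s1 s2].
Proof.
rewrite /nonoverlapping all_cat pairwise_cat.
by case: all; case: all; case: allrel; case: pairwise; case: pairwise.
Qed.

Lemma nonoverlapping_refine a b s p l s' : itv_partition p.1 p.2 l ->
  nonoverlapping a b (s ++ p :: s') ->
  nonoverlapping a b (s ++ pieces p.1 l ++ s').
Proof.
move=> pl; have /andP[pa pp] := pieces_nonoverlapping pl.
rewrite -cat1s !nonoverlapping_cat.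
move=> /and3P[s1 /and3P[p1 s'1 ps'] ss']; rewrite s1 s'1 /=.
have := ss'; rewrite !allrel_catr => /andP[sp ->]; rewrite andbT.
move: p1; rewrite /nonoverlapping/= !andbT => /and3P[ap _ pb].
rewrite pp andbT -andbA; apply/and3P; split.
- by apply: sub_all pa => q /and3P[pq -> qp]; rewrite (le_trans ap pq) (le_trans qp pb).
- apply/allrelP => q t qpl ts'.
  have /and3P[pq _ qp] := allP pa _ qpl.
  have /allrelP/(_ p t) := ps'; rewrite inE eqxx => /(_ erefl ts') /orP[h|h].
    by rewrite (le_trans qp h).
  by rewrite (le_trans h pq) orbT.
- apply/allrelP => t q ts qpl.
  have /and3P[pq _ qp] := allP pa _ qpl.
  have /allrelP/(_ t p) := sp; rewrite inE eqxx => /(_ ts erefl) /orP[h|h].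
    by rewrite (le_trans h pq).
  by rewrite (le_trans qp h) orbT.
Qed.

(** A sum of total variations is a supremum over partitions of all the intervals, and the pieces
    form again a nonoverlapping family of the same total length, so the [d] of [abs_continuous_seq]
    serves. *)
Lemma abs_continuous_total_variation a b f e : abs_continuous a b f -> 0 < e ->
  exists2 d, 0 < d & forall s, nonoverlapping a b s ->
    \sum_(p <- s) (p.2 - p.1) < d ->
    (\sum_(p <- s) total_variation p.1 p.2 f <= e%:E)%E.
Proof.
move=> acf e0; have [d d0 H] := abs_continuous_seq acf e0; exists d => // s sab sd.
(* [s'] collects the pieces of the intervals already partitioned, [s] those still measured by their
   total variation. *)
suff G s' : nonoverlapping a b (s' ++ s) ->
    \sum_(p <- s' ++ s) (p.2 - p.1) < d ->
    ((\sum_(p <- s') `|f p.2 - f p.1|)%:E +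
     \sum_(p <- s) total_variation p.1 p.2 f <= e%:E)%E.
  by have := G [::] sab sd; rewrite big_nil add0e.
elim: s s' {sab sd} => [s' s1 s2|p s ih s' s1 s2].
  by rewrite big_nil adde0 lee_fin H// -[s']cats0.
have p12 : p.1 <= p.2.
  by move: s1; rewrite /nonoverlapping all_cat => /andP[/andP[_ /andP[/and3P[]]]].
have tv0 : (0 <= \sum_(p <- s) total_variation p.1 p.2 f)%E.
  rewrite big_seq; apply: sume_ge0 => q qs; apply: total_variation_ge0.
  move: s1; rewrite /nonoverlapping all_cat => /andP[/andP[_ /andP[_]]].
  by move=> /allP/(_ _ qs)/and3P[].
suff G l : itv_partition p.1 p.2 l ->
    (((\sum_(q <- s') `|f q.2 - f q.1| + variation p.1 p.2 f l)%:E +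
     \sum_(q <- s) total_variation q.1 q.2 f) <= e%:E)%E.
  have X l : itv_partition p.1 p.2 l ->
    (((\sum_(q <- s') `|f q.2 - f q.1|)%:E + (variation p.1 p.2 f l)%:E +
     \sum_(q <- s) total_variation q.1 q.2 f) <= e%:E)%E by [apply: G].
  (* The remaining sum must be finite before it can be subtracted; the bound for a single partition
     shows that it is. *)
  have tvf : (\sum_(q <- s) total_variation q.1 q.2 f \is a fin_num)%E.
    have [l pl] : exists l, itv_partition p.1 p.2 l.
      move: p12; rewrite le_eqVlt => /predU1P[->|p12].
        by exists [::]; split => //=.
      by exists [:: p.2]; exact: itv_partition1.
    have := X _ pl; rewrite ge0_fin_numE// => Y.
    rewrite -(lteD2lE (x := (\sum_(q <- s') `|f q.2 - f q.1| + variation p.1 p.2 f l)%:E))//.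
    by rewrite addey// (le_lt_trans Y)// ltry.
  rewrite big_cons addeCA -leeBrDr ?fin_numD ?tvf//.
  apply: ge_ereal_sup => _ [_ [l pl <-] <-].
  rewrite leeBrDr ?fin_numD ?tvf//; apply: le_trans (X _ pl).
  by rewrite addeCA -addeA.
move=> pl; rewrite (piecesE _ pl) -big_cat; apply: ih; rewrite -catA.
  exact: nonoverlapping_refine.
rewrite !big_cat/= (pieces_length pl).
by move: s2; rewrite big_cat big_cons/=.
Qed.

End ac.

(** * Densities of absolutely continuous monotone functions *)

Section density.
Context {R : realType}.
Notation mu := (@lebesgue_measure R).
Implicit Types (a b : R) (F : R -> R) (s : seq (R * R)).

Definition mono_ac a b F := forall e, 0 < e ->
  exists2 d, 0 < d & forall s, nonoverlapping a b s ->
    \sum_(p <- s) (p.2 - p.1) < d -> \sum_(p <- s) (F p.2 - F p.1) <= e.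

Lemma stieltjes_itv_bnd (F : cumulative R R) a b : a <= b ->
  lebesgue_stieltjes_measure F `]a, b] = (F b - F a)%:E.
Proof.
move=> ab; rewrite /lebesgue_stieltjes_measure /measure_extension.
by rewrite measurable_mu_extE/= ?wlength_itv_bnd//; exact: is_ocitv.
Qed.

(** The pair consists of the infimum and the supremum of the trace on ]a, b]; the infimum is not
    attained because [I] is open and [a] is excluded. An empty trace gets the degenerate pair
    [(a, a)], which still lies in [a, b]. *)
Lemma open_itv_hull a b (I : set R) : a <= b -> open I -> is_interval I ->
  exists p : R * R, [/\ a <= p.1, p.1 < p.2 \/ p = (a, a), p.2 <= b,
    I `&` `]a, b] `<=` `]p.1, p.2] & `]p.1, p.2[ `<=` I `&` `]a, b]].
Proof.
move=> ab oI iI; pose J := I `&` `]a, b]%classic.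
have [J0|/set0P [x0 Jx0]] := eqVneq J set0.
  exists (a, a) => /=; split => //; first by right.
    by rewrite -/J J0.
  by move=> x /=; rewrite in_itv/= => /andP[/lt_trans h /h]; rewrite ltxx.
have lJ : has_lbound J by exists a => x [_ /=]; rewrite in_itv/= => /andP[/ltW].
have uJ : has_ubound J by exists b => x [_ /=]; rewrite in_itv/= => /andP[].
have ax0 : a <= inf J.
  by apply: lb_le_inf; [exists x0|move=> x [_ /=]; rewrite in_itv/= => /andP[/ltW]].
have bx0 : sup J <= b.
  by apply: ge_sup; [exists x0|move=> x [_ /=]; rewrite in_itv/= => /andP[]].
have hJ : J `<=` `]inf J, sup J].
  move=> x Jx /=; rewrite in_itv/= (ub_le_sup uJ)// andbT lt_neqAle.
  rewrite ge_inf// andbT; apply/negP => /eqP xE.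
  case: Jx => Ix /=; rewrite in_itv/= => /andP[ax xb].
  have : \forall y \near x^'-, I y.
    by apply: cvg_within; exact: open_nbhs_nbhs.
  have : \forall y \near x^'-, a < y by exact: nbhs_left_gt.
  have : \forall y \near x^'-, y < x by exact: nbhs_left_lt.
  move=> near1 near2 near3.
  have [y [yx ay Iy]] : exists y, [/\ y < x, a < y & I y].
    have /filter_ex[y [? ? ?]] : \forall y \near x^'-, [/\ y < x, a < y & I y].
      by near=> y; split; near: y.
    by exists y.
  have : inf J <= y.
    apply: ge_inf => //; split=> //=.
    by rewrite in_itv/= ay (ltW (lt_le_trans yx xb)).
  by rewrite xE leNgt yx.
exists (inf J, sup J) => /=; split => //.
  by left; have := hJ _ Jx0; rewrite /= in_itv/= => /andP[/lt_le_trans]; apply.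
move=> x /=; rewrite in_itv/= => /andP[ix xs].
have [y Jy yx] : exists2 y, J y & y < x.
  by have [|y Jy yx] := inf_lt _ ix; [exists x0|exists y].
have [z Jz zx] : exists2 z, J z & x < z.
  by have [|z Jz zx] := sup_gt _ xs; [exists x0|exists z].
case: Jy Jz => Iy + [Iz +]; rewrite /= !in_itv/= => /andP[ay _] /andP[_ zb].
split; first by apply: (iI y z) => //; rewrite !ltW.
by move: (lt_trans ay yx) (lt_le_trans zx zb) => ax1 xb1; rewrite ax1 ltW.
Unshelve. all: by end_near. Qed.

(** A null set is covered by an open set of measure below [d]. Its components, cut to ]a, b], are
    nonoverlapping intervals of total length below [d], so [nu] of finitely many of them is at most
    [e]. *)
Lemma mono_ac_dominated a b F (nu : {measure set (measurableTypeR R) -> \bar R}) :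
  a <= b -> mono_ac a b F -> {homo F : u v / u <= v} ->
  (forall A, measurable A -> nu A = nu (A `&` `]a, b]%classic)) ->
  (forall u v, a <= u -> u <= v -> v <= b ->
     (nu `]u, v]%classic <= (F v - F u)%:E)%E) ->
  nu `<< mu.
Proof.
move=> ab acF ndF nuab nuF.
suff key N : measurable N -> mu N = 0 -> nu N = 0.
  by move=> N0 mN0 A mA AN0; apply: key => //; apply: mN0.
move=> mN N0; apply/eqP; rewrite eq_le measure_ge0 andbT.
apply/lee_addgt0Pr => e e0; rewrite add0e.
have [d d0 H] := acF _ e0.
have [U [oU NU UN]] : exists U, [/\ open U, N `<=` U & (mu U < d%:E)%E].
  have muNy : (mu N < +oo)%E by rewrite N0 ltry.
  have [U [oU NU UN]] := lebesgue_regularity_outer mN muNy d0.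
  have mU := open_measurable oU.
  have muUN : mu (U `&` N) = 0%E.
    by apply: subset_measure0 N0 => //; exact: measurableI.
  have muUE : mu U = (mu (U `\` N) + mu (U `&` N))%E by exact: measureDI.
  by exists U; split => //; rewrite muUE muUN adde0.
pose I := open_disjoint_itv oU.
have mI i : measurable (I i) by apply: open_measurable; exact: open_disjoint_itv_open.
have tI : trivIset setT I by exact: open_disjoint_itv_trivIset.
have UE : U = \bigcup_q I q by exact: open_disjoint_itv_bigcup.
have /choice[p pP] i := open_itv_hull ab (@open_disjoint_itv_open _ _ oU i)
  (@open_disjoint_itv_is_interval _ _ oU i).
rewrite -/I in pP.
have mU : measurable U by exact: open_measurable.
apply: (@le_trans _ _ (nu U)); first by apply: le_measure; rewrite ?inE.
rewrite UE (@measure_bigcup _ _ _ nu [set: nat] I (fun i _ => mI i) tI).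
have muU : mu U = (\sum_(0 <= i <oo | i \in [set: nat]) mu (I i))%E.
  by rewrite [in LHS]UE (@measure_bigcup _ _ _ mu [set: nat] I (fun i _ => mI i) tI).
apply: lime_le; first by apply: is_cvg_nneseries => *; exact: measure_ge0.
apply: nearW => n.
pose s := [seq p i | i <- iota 0 n].
have p12 i : (p i).1 <= (p i).2 by have [_ [/ltW//|->]] := pP i.
apply: (@le_trans _ _ (\sum_(q <- s) (F q.2 - F q.1))%:E).
  rewrite big_map -sumEFin /index_iota subn0 big_mkcond; apply: lee_sum => i _.
  case: ifP => // _; last first.
    by rewrite lee_fin subr_ge0 ndF.
  have [ai _ ib Ii _] := pP i.
  apply: le_trans (nuF _ _ ai (p12 i) ib); rewrite [leLHS]nuab; last exact: mI.
  apply: le_measure; rewrite ?inE//.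
  apply: measurableI; [exact: mI|exact: measurable_itv].
rewrite lee_fin; apply: H.
  rewrite /nonoverlapping; apply/andP; split.
    by apply/allP => q /mapP[i _ ->]; have [-> _ -> _ _] := pP i; rewrite p12.
  rewrite pairwise_map.
  have := iota_uniq 0 n; rewrite uniq_pairwise; apply: sub_pairwise => i j /= ij.
  have [ai pi _ _ Ii] := pP i; have [aj pj _ _ Ij] := pP j.
  rewrite !leNgt -negb_and; apply/negP => /andP[ji ij'].
  case: pi => [pi|pi]; last by move: ji; rewrite pi/= ltNge aj.
  case: pj => [pj|pj]; last by move: ij'; rewrite pj/= ltNge ai.
  (* Two overlapping hulls would share a point lying in two disjoint components. *)
  have m : Num.max (p i).1 (p j).1 < Num.min (p i).2 (p j).2.
    by rewrite gt_max !lt_min pi pj ji ij'.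
  have [z /andP[]] : exists z, Num.max (p i).1 (p j).1 < z < Num.min (p i).2 (p j).2.
    by exists ((Num.max (p i).1 (p j).1 + Num.min (p i).2 (p j).2) / 2); rewrite !midf_lt.
  rewrite gt_max lt_min => /andP[iz jz] /andP[zi zj].
  have [Iiz _] : (I i `&` `]a, b]) z by apply: Ii; rewrite /= in_itv/= iz zi.
  have [Ijz _] : (I j `&` `]a, b]) z by apply: Ij; rewrite /= in_itv/= jz zj.
  have /trivIsetP/(_ i j Logic.I Logic.I ij) := tI.
  by move=> /seteqP[/(_ z (conj Iiz Ijz))].
rewrite -lte_fin; apply: le_lt_trans UN.
rewrite muU; apply: le_trans (nneseries_lim_ge n _) => //.
rewrite big_map -sumEFin /index_iota subn0 [leRHS]big_mkcond; apply: lee_sum => i _.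
rewrite in_setT.
have [_ _ _ _ Ii] := pP i.
apply: (@le_trans _ _ (mu `](p i).1, (p i).2[)).
  rewrite lebesgue_measure_itv/= lte_fin.
  by case: ltgtP (p12 i) => // -> _; rewrite subrr.
apply: le_measure; rewrite ?inE; [exact: measurable_itv|exact: mI|].
by move=> x /Ii[].
Qed.
End density.

Section density2.
Context {R : realType}.
Notation mu := (@lebesgue_measure R).

(** [g] is the Radon-Nikodym derivative of the Stieltjes measure of [F], restricted to ]a, b] to
    make it finite. *)
Lemma mono_ac_density (a b : R) (F : R -> R) : a < b -> mono_ac a b F ->
  {homo F : u v / u <= v} -> continuous F ->
  exists2 g : R -> R, mu.-integrable setT (EFin \o g) &
    forall s t, a <= s -> s <= t -> t <= b ->
      F t - F s = \int[mu]_(x in `]s, t]) g x.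
Proof.
move=> ab acF ndF cF.
pose Fc : cumulative R R := HB.pack F
  (isCumulative.Build R _ R F ndF (right_continuousW cF)).
pose lsF : {measure set (measurableTypeR R) -> \bar R} :=
  lebesgue_stieltjes_measure Fc.
have mab : measurable (`]a, b]%classic : set (measurableTypeR R)).
  exact: measurable_itv.
have lsFab u v : u <= v -> lsF `]u, v]%classic = (F v - F u)%:E.
  exact: (stieltjes_itv_bnd Fc).
have fin : (lsF `]a, b]%classic < +oo)%E by rewrite lsFab ?ltry// ltW.
pose nu : {finite_measure set (measurableTypeR R) -> \bar R} := mfrestr mab fin.
have nuE A : nu A = lsF (A `&` `]a, b]%classic) by [].
have numu : nu `<< mu.
  apply: (mono_ac_dominated (ltW ab) acF ndF).
    by move=> A mA; rewrite /= /mfrestr /mrestr -setIA setIid.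
  move=> u v au uv vb; rewrite -lsFab// [leLHS]nuE.
  by apply: le_measure; rewrite ?inE//; apply: measurableI => //; exact: measurable_itv.
have [g [g0 gfin gi gE]] := radon_nikodym_sigma_finite numu.
exists (fine \o g).
  by apply: eq_integrable gi => // x _ /=; rewrite fineK.
move=> s t as_ st tb; rewrite /Rintegral.
under eq_integral do rewrite /= fineK//.
rewrite -gE; last exact: measurable_itv.
rewrite nuE setIidl ?lsFab//.
by move=> x /=; rewrite !in_itv/= => /andP[/(le_lt_trans as_) -> /le_trans]; apply.
Qed.

End density2.

(** * The fundamental theorem of calculus for absolutely continuous functions *)

Section ac_ftc.
Context {R : realType}.
Notation mu := (@lebesgue_measure R).
Implicit Types (a b : R) (f : R -> R).

(** The variation is at most 1 on each interval shorter than the [d] that belongs to 1; real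
    induction adds up such intervals. *)
Lemma abs_continuous_bounded_variation a b f : a <= b ->
  abs_continuous a b f -> total_variation a b f \is a fin_num.
Proof.
move=> ab acf; have [d d0 H] := abs_continuous_total_variation acf (@ltr01 R).
apply: (@real_induction _ a b (fun t => total_variation a t f \is a fin_num)) => //.
  by rewrite total_variationxx.
move=> x _; exists (d / 2); first by rewrite divr_gt0.
move=> s t as_ ds sx xt td tb sfin; have st := le_trans sx xt.
rewrite (total_variationD _ as_ st) fin_numD sfin/=.
rewrite ge0_fin_numE ?total_variation_ge0//.
apply: (@le_lt_trans _ _ 1%:E); last exact: ltry.
have := H [:: (s, t)]; rewrite !big_seq1 /nonoverlapping/= as_ st tb => /(_ isT).
by apply; lra.
Qed.

Lemma abs_continuous_density a b f : a < b -> {within `[a, b], continuous f} ->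
  abs_continuous a b f ->
  exists2 g : R -> R, mu.-integrable setT (EFin \o g) &
    forall s t, a <= s -> s <= t -> t <= b ->
      f t - f s = \int[mu]_(x in `]s, t]) g x.
Proof.
move=> ab cf acf; have abW := ltW ab.
have fin s t : a <= s -> s <= t -> t <= b -> total_variation s t f \is a fin_num.
  move=> as_ st tb; have := abs_continuous_bounded_variation abW acf.
  rewrite (total_variationD _ as_ (le_trans st tb)) fin_numD => /andP[_].
  by rewrite (total_variationD _ st tb) fin_numD => /andP[].
pose T t := fine (total_variation a t f).
have TB s t : a <= s -> s <= t -> t <= b ->
    (T t - T s)%:E = total_variation s t f.
  move=> as_ st tb; rewrite /T (total_variationD _ as_ st) fineD ?fin//; last first.
    exact: le_trans st tb.
  by rewrite addrAC subrr add0r fineK// fin.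
have Tf s t : a <= s -> s <= t -> t <= b -> `|f t - f s| <= T t - T s.
  by move=> as_ st tb; rewrite -lee_fin TB// total_variation_ge.
have cT : {within `[a, b], continuous T}.
  apply: total_variation_continuous => //.
  by apply/(bounded_variationP _ abW); exact: fin.
(* The Jordan decomposition [f = T - (T - f)], both parts being extended by constants beyond
   [a, b]. *)
pose F1 := T \o clamp a b; pose F2 := fun t => F1 t - f (clamp a b t).
have cF1 : continuous F1 by exact: clamp_continuous.
have cF2 : continuous F2.
  by move=> x; apply: cvgB; [exact: cF1|exact: clamp_continuous].
have ndF1 : {homo F1 : u v / u <= v}.
  move=> u v uv; rewrite /F1/= -subr_ge0.
  have /andP[? ?] := clamp_itv u abW; have /andP[? ?] := clamp_itv v abW.
  by apply: le_trans (Tf _ _ _ _ _) => //; exact: clamp_homo.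
have ndF2 : {homo F2 : u v / u <= v}.
  move=> u v uv; rewrite /F2 /F1/=.
  have /andP[au _] := clamp_itv u abW; have /andP[_ vb] := clamp_itv v abW.
  have := Tf _ _ au (@clamp_homo _ a b _ _ uv) vb; rewrite ler_norml; lra.
have F1E t : a <= t <= b -> F1 t = T t by move=> tab; rewrite /F1/= clamp_id.
have F2E t : a <= t <= b -> F2 t = T t - f t by move=> tab; rewrite /F2 F1E// clamp_id.
have ac1 : mono_ac a b F1.
  move=> e e0; have [d d0 H] := abs_continuous_total_variation acf e0.
  exists d => // s sab sd; rewrite -lee_fin; apply: le_trans (H _ sab sd).
  rewrite -sumEFin big_seq [leRHS]big_seq; apply: lee_sum => p ps.
  have /andP[/allP/(_ _ ps)/and3P[ap pp pb] _] := sab.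
  by rewrite !F1E ?TB// ?ap ?pb ?(le_trans ap) ?(le_trans pp).
have ac2 : mono_ac a b F2.
  move=> e e0; have e20 : 0 < e / 2 by rewrite divr_gt0.
  have [d d0 H] := ac1 _ e20.
  have [d' d'0 H'] := abs_continuous_seq acf e20.
  exists (Num.min d d'); first by rewrite lt_min d0.
  move=> s sab; rewrite lt_min => /andP[sd sd'].
  have := lerD (H _ sab sd) (H' _ sab sd'); rewrite -splitr; apply: le_trans.
  rewrite -big_split/= big_seq [leRHS]big_seq; apply: ler_sum => p ps.
  have /andP[/allP/(_ _ ps)/and3P[ap pp pb] _] := sab.
  rewrite !F1E ?F2E ?ap ?pb ?(le_trans ap) ?(le_trans pp)//.
  have := ler_norm (- (f p.2 - f p.1)); rewrite normrN; lra.
have [g1 ig1 g1E] := mono_ac_density ab ac1 ndF1 cF1.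
have [g2 ig2 g2E] := mono_ac_density ab ac2 ndF2 cF2.
exists (g1 \- g2).
  by apply: eq_integrable (integrableB measurableT ig1 ig2) => // x _ /=.
move=> s t as_ st tb; rewrite RintegralB//; last 2 first.
  exact: integrableS ig1.
  exact: integrableS ig2.
rewrite -g1E// -g2E// !F1E ?F2E ?as_ ?tb ?(le_trans as_) ?(le_trans st)//.
by ring.
Qed.

Lemma abs_continuous_FTC a b f : a < b -> {within `[a, b], continuous f} ->
  abs_continuous a b f ->
  exists2 g : R -> R, mu.-integrable setT (EFin \o g) &
    (forall s t, a <= s -> s <= t -> t <= b ->
      f t - f s = \int[mu]_(x in `]s, t]) g x) /\
    {ae mu, forall x, a < x < b -> derive1 f x = g x}.
Proof.
move=> ab cf acf; have [g ig gE] := abs_continuous_density ab cf acf.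
exists g => //; split => //.
have igS (i : interval R) : mu.-integrable [set` i] (EFin \o g).
  by apply: integrableS ig.
have lg : locally_integrable setT g by exact: open_integrable_locally openT ig.
have := FTC1Ny (fun y => igS `]-oo, y]) lg.
apply: filterS; first exact: (ae_filter_ringOfSetsType mu).
move=> x [dG <-] /andP[ax xb].
set G := fun y => _ in dG *.
rewrite !derive1E.
(* [G] is the integral of the density from [-oo]. Inside ]a, b[ it differs from [f] by a constant,
   and Lebesgue differentiation applies to it. *)
transitivity ('D_1 (fun y => f a - G a + G y) x).
  apply: near_eq_derive.
  near=> y.
  have ay : a <= y by apply: ltW; near: y; exact: lt_nbhsr.
  have yb : y <= b by apply: ltW; near: y; exact: lt_nbhsl.
  have := gE a y (lexx a) ay yb.
  rewrite -(@Rintegral_itvB _ _ -oo%O (BRight y))//= => E.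
  by rewrite -addrA (addrC (- G a)) -E; ring.
rewrite deriveD; [|exact: derivable_cst|exact: dG].
by rewrite derive_cst add0r.
Unshelve. all: by end_near. Qed.

End ac_ftc.

(** * The slope of the value function *)

Definition bellman_data (R : realType) (D r c y : R) (h : R -> R) :=
  [/\ 0 < D, 0 < r & 0 < c] /\
  [/\ {within `[0, D], continuous h},
      forall u v : R, 0 <= u -> u < v -> v <= D -> h u < h v,
      h 0 = 0 & r / (4 * c) <= - y].

Section bellman_slope.
Context {R : realType}.
Variables (D r c y : R) (h : R -> R).
Hypothesis gd : bellman_data D r c y h.
Let hD : 0 < D. Proof. by case: gd => -[]. Qed.
Let hr : 0 < r. Proof. by case: gd => -[]. Qed.
Let hc : 0 < c. Proof. by case: gd => -[]. Qed.
Let h_cont : {within `[0, D], continuous h}. Proof. by case: gd => _ []. Qed.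
Let h_incr u v : 0 <= u -> u < v -> v <= D -> h u < h v.
Proof. by case: gd => _ [_ + _ _]; apply. Qed.
Let h_0 : h 0 = 0. Proof. by case: gd => _ []. Qed.
Let hy : r / (4 * c) <= - y. Proof. by case: gd => _ []. Qed.
Notation mu := (@lebesgue_measure R).

Definition hamiltonian (p : R) := - (1 / (4 * c)) * p ^+ 2 - y * p.
Local Notation H := hamiltonian.

(** The extension by constants is continuous, nondecreasing and nonnegative on the whole line, which
    frees [slope] from side conditions. *)
Definition hext := h \o clamp 0 D.

(** The smaller root of [H p = hext x]. Where the discriminant is negative, the square root is 0 by
    convention and the value is the vertex of the parabola, so that the function stays continuous
    and nondecreasing. *)
Definition minus_root x := - (2 * c * y) - Num.sqrt (4 * c ^+ 2 * y ^+ 2 - 4 * c * hext x).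

Definition slope x := if hext x <= H r then minus_root x else r.

Lemma hextE x : 0 <= x <= D -> hext x = h x.
Proof. by move=> x0D; rewrite /hext/= clamp_id. Qed.

Lemma hext_continuous : continuous hext.
Proof. exact: clamp_continuous (ltW hD) h_cont. Qed.

Lemma h_homo u v : 0 <= u -> u <= v -> v <= D -> h u <= h v.
Proof.
by move=> u0; rewrite le_eqVlt => /predU1P[->//|uv vD]; apply/ltW/h_incr.
Qed.

Lemma hext_homo : {homo hext : u v / u <= v}.
Proof.
move=> u v uv; have /andP[? _] := clamp_itv u (ltW hD).
have /andP[_ ?] := clamp_itv v (ltW hD).
by apply: h_homo => //; apply: (@clamp_homo _ 0 D).
Qed.

Lemma hext_ge0 x : 0 <= hext x.
Proof.
rewrite -h_0; have /andP[? ?] := clamp_itv x (ltW hD).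
exact: h_homo.
Qed.

Lemma hamiltonianE p : H p = p * (- y - p / (4 * c)).
Proof. by rewrite /hamiltonian; field; rewrite gt_eqF. Qed.

Lemma hamiltonian_r_ge0 : 0 <= H r.
Proof. by rewrite hamiltonianE; apply: mulr_ge0; [exact: ltW|rewrite subr_ge0]. Qed.

Lemma y_lt0 : y < 0.
Proof. by rewrite -oppr_gt0 (lt_le_trans _ hy)// divr_gt0// mulr_gt0. Qed.

Let c4_gt0 : 0 < 4 * c. Proof. by rewrite mulr_gt0. Qed.

(** Completing the square: values of [H] are compared through squared distances to the vertex
    [- (2 * c * y)]. *)
Lemma discriminant p :
  4 * c ^+ 2 * y ^+ 2 - 4 * c * H p = (2 * c * y + p) ^+ 2.
Proof. by rewrite hamiltonianE; field; rewrite gt_eqF. Qed.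

Lemma le_hamiltonian p q :
  (H p <= H q) = ((2 * c * y + q) ^+ 2 <= (2 * c * y + p) ^+ 2).
Proof. by rewrite -!discriminant lerD2l lerN2 ler_pM2l. Qed.

Lemma lt_hamiltonian p q :
  (H p < H q) = ((2 * c * y + q) ^+ 2 < (2 * c * y + p) ^+ 2).
Proof. by rewrite -!discriminant ltrD2l ltrN2 ltr_pM2l. Qed.

Lemma hamiltonian_homo p q : p <= q -> q <= - (2 * c * y) -> H p <= H q.
Proof. by move=> pq qy; rewrite le_hamiltonian; nra. Qed.

Lemma hamiltonian_lt p q : p < q -> q <= - (2 * c * y) -> H p < H q.
Proof. by move=> pq qy; rewrite lt_hamiltonian; nra. Qed.

Lemma hamiltonian_concave p q s : p <= q -> q <= s ->
  Num.min (H p) (H s) <= H q.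
Proof.
move=> pq qs; have [qy|yq] := leP q (- (2 * c * y)).
  by rewrite ge_min hamiltonian_homo.
by rewrite ge_min [X in _ || X]le_hamiltonian; apply/orP; right; nra.
Qed.

Lemma hamiltonian_concave_lt p q s x : p < q -> q < s ->
  x <= H p -> x <= H s -> x < H q.
Proof.
move=> pq qs xp xs; have [qy|yq] := leP q (- (2 * c * y)).
  by apply: le_lt_trans xp _; exact: hamiltonian_lt.
by apply: le_lt_trans xs _; rewrite lt_hamiltonian; nra.
Qed.

(** At the level [H r] the discriminant is a square, and a lower level increases it. *)
Lemma disc_ge0 x : hext x <= H r -> 0 <= 4 * c ^+ 2 * y ^+ 2 - 4 * c * hext x.
Proof.
move=> xr; apply: (@le_trans _ _ ((2 * c * y + r) ^+ 2)); first exact: sqr_ge0.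
by rewrite -discriminant lerD2l lerN2 ler_pM2l.
Qed.

Lemma minus_root_le x : minus_root x <= - (2 * c * y).
Proof. by rewrite /minus_root gerBl. Qed.

Lemma hamiltonian_minus_root x : hext x <= H r -> H (minus_root x) = hext x.
Proof.
move=> xr; have := discriminant (minus_root x).
rewrite (_ : 2 * c * y + minus_root x =
  - Num.sqrt (4 * c ^+ 2 * y ^+ 2 - 4 * c * hext x)); last by rewrite /minus_root; ring.
rewrite sqrrN sqr_sqrtr ?disc_ge0// => /addrI/oppr_inj/mulfI; apply.
by rewrite gt_eqF.
Qed.

Lemma minus_root_ge0 x : 0 <= minus_root x.
Proof.
have cy : 0 <= - (2 * c * y).
  have : 0 < c * - y by rewrite mulr_gt0// oppr_gt0 y_lt0.
  lra.
rewrite /minus_root subr_ge0 -(ger0_norm cy) -sqrtr_sqr ler_wsqrtr//.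
have := mulr_ge0 (ltW hc) (hext_ge0 x); lra.
Qed.

Lemma minus_root_ler x : hext x <= H r -> minus_root x <= r.
Proof.
move=> xr; have [//|rx] := leP (minus_root x) r.
have := hamiltonian_lt rx (minus_root_le x).
by rewrite hamiltonian_minus_root// ltNge xr.
Qed.

Lemma minus_root_homo : {homo minus_root : u v / u <= v}.
Proof.
by move=> u v uv; rewrite /minus_root lerD2l lerN2 ler_wsqrtr// lerD2l lerN2 ler_pM2l// hext_homo.
Qed.

Lemma minus_root_continuous : continuous minus_root.
Proof.
move=> x; apply: cvgB; first exact: cvg_cst.
apply: continuous_comp; last exact: sqrt_continuous.
apply: cvgB; first exact: cvg_cst.
by apply: cvgM; [exact: cvg_cst|exact: hext_continuous].
Qed.

Lemma slope_ge0 x : 0 <= slope x.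
Proof. by rewrite /slope; case: ifP => _; rewrite ?minus_root_ge0// ltW. Qed.

Lemma slope_ler x : slope x <= r.
Proof. by rewrite /slope; case: ifP => // /minus_root_ler. Qed.

Lemma slope_homo : {homo slope : u v / u <= v}.
Proof.
move=> u v uv; rewrite /slope; case: ifPn => [ur|].
  by case: ifP => [_|_]; [exact: minus_root_homo|exact: minus_root_ler].
case: ifPn => // /[swap]; rewrite -ltNge => ru /(le_trans (hext_homo uv)).
by rewrite leNgt ru.
Qed.

Lemma slope_low x : hext x <= H r -> slope x = minus_root x.
Proof. by rewrite /slope => ->. Qed.

Lemma slope_high x : H r < hext x -> slope x = r.
Proof. by rewrite /slope leNgt => ->. Qed.

Lemma hamiltonian_slope x : H (slope x) <= hext x.
Proof.
rewrite /slope; case: ifPn => [xr|]; first by rewrite hamiltonian_minus_root.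
by rewrite -ltNge => /ltW.
Qed.

Lemma hamiltonian_slope_low x : hext x <= H r -> H (slope x) = hext x.
Proof. by move=> xr; rewrite slope_low// hamiltonian_minus_root. Qed.

Lemma slope_low_vertex x : hext x <= H r -> slope x <= - (2 * c * y).
Proof. by move=> xr; rewrite slope_low// minus_root_le. Qed.

(** Strictness is what gives a negative drift [y + p / (2 * c)] to the momentum [p = slope x] in the
    lower bound. *)
Lemma slope_low_lt_vertex x : hext x < H r -> slope x < - (2 * c * y).
Proof.
move=> xr; rewrite slope_low ?ltW// lt_neqAle minus_root_le andbT.
apply/negP => /eqP E; have := hamiltonian_minus_root (ltW xr).
rewrite E => Hx; move: xr; rewrite -Hx lt_hamiltonian addrN expr0n/=.
by rewrite ltNge sqr_ge0.
Qed.

(** By concavity [H] exceeds [hext x] strictly between [slope x] and [r]. *)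
Lemma sub_slope_le x p : hext x < H r -> p <= r -> H p <= hext x -> p <= slope x.
Proof.
move=> xr; rewrite le_eqVlt => /predU1P[->|pr px]; first by rewrite leNgt xr.
rewrite leNgt; apply/negP => xp; move: px; rewrite leNgt => /negP; apply.
have xr' := ltW xr.
by apply: (hamiltonian_concave_lt xp pr) => //; rewrite hamiltonian_slope_low.
Qed.

(** Between [slope x] and [r], concavity keeps [H] above its smaller end value, which is [hext x] at
    low levels. *)
Lemma slope_super x p : slope x <= p -> hext x <= H p \/ r <= p.
Proof.
move=> xp; have [xr|xr] := leP (hext x) (H r); last by right; rewrite -(slope_high xr).
have [pr|] := leP r p; [by right|move=> pr; left].
have := hamiltonian_concave xp (ltW pr).
by rewrite hamiltonian_slope_low// min_l.
Qed.

(** Continuity is one-sided: just above the last level with [hext <= H r] the slope may jump up to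
    [r]. *)
Lemma slope_left_continuous x e : 0 < e -> exists2 d, 0 < d &
  forall z, x - d < z -> z <= x -> slope x - e <= slope z.
Proof.
move=> e0; have [xr|xr] := leP (hext x) (H r).
  have /cvgrPdist_le/(_ _ e0)/nbhs_ballP[d /= d0 Hd] := @minus_root_continuous x.
  exists d => // z xz zx; have zr := le_trans (hext_homo zx) xr.
  rewrite !slope_low//; have := Hd z; rewrite /ball/= ger0_norm ?subr_ge0//.
  move=> /(_ _); rewrite ler_norml lerBlDr => /(_ _)/andP[|_]; first lra.
  lra.
have /cvgr_gt/(_ _ xr)/nbhs_ballP[d /= d0 Hd] := @hext_continuous x.
exists d => // z xz zx; rewrite (slope_high xr).
have -> : slope z = r; last by rewrite gerBl ltW.
by apply: slope_high; apply: Hd; rewrite /ball/= ger0_norm ?subr_ge0//; lra.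
Qed.

Lemma slope_integrable (a b : R) : mu.-integrable `]a, b] (EFin \o slope).
Proof.
apply: (@bounded_itv_integrable _ _ _ false false _ r).
  by apply: nondecreasing_measurable => //; exact: slope_homo.
by move=> t _; rewrite ger0_norm ?slope_ge0// slope_ler.
Qed.

Definition slope_primitive x := \int[mu]_(t in `]0, x]) slope t.

Lemma slope_primitiveB s t : 0 <= s -> s <= t ->
  slope_primitive t - slope_primitive s = \int[mu]_(u in `]s, t]) slope u.
Proof.
move=> s0 st; rewrite /slope_primitive.
rewrite (@Rintegral_itvB _ _ (BRight 0) (BRight t))//.
exact: slope_integrable.
Qed.

Lemma slope_primitive_bounds s t : 0 <= s -> s <= t ->
  slope s * (t - s) <= slope_primitive t - slope_primitive s <= slope t * (t - s).
Proof.
move=> s0 st; rewrite slope_primitiveB//.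
rewrite -!(Rintegral_itv_cst false false _ st).
apply/andP; split; apply: le_Rintegral => //; try exact: slope_integrable;
  try exact: cst_itv_integrable;
  by move=> x /=; rewrite in_itv/= => /andP[sx xt]; apply: slope_homo; rewrite // ltW.
Qed.

Lemma slope_primitive0 : slope_primitive 0 = 0.
Proof. by rewrite /slope_primitive set_itv_ge ?bnd_simp ?ltxx// Rintegral_set0. Qed.

(** The level is the supremum of the set where [hext <= H r]. This set contains 0 because
    [h 0 = 0 <= H r], which is where the assumption on [y] enters. *)
Lemma switch_level : exists xs, [/\ 0 <= xs <= D, hext xs <= H r,
  forall x, x <= xs -> hext x <= H r &
  forall x, xs < x -> x <= D -> H r < hext x].
Proof.
pose S := [set x | 0 <= x <= D /\ hext x <= H r].
have S0 : S 0.
  split; first by rewrite lexx ltW.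
  by rewrite hextE ?h_0 ?hamiltonian_r_ge0// lexx ltW.
have uS : has_ubound S by exists D => x [/andP[]].
have S0s : 0 <= sup S by exact: ub_le_sup.
have sD : sup S <= D by apply: ge_sup; [exists 0|move=> x [/andP[]]].
have hs : hext (sup S) <= H r.
  rewrite leNgt; apply/negP => rs.
  have /cvgr_gt/(_ _ rs)/nbhs_ballP[d /= d0 Hd] := @hext_continuous (sup S).
  have [z Sz dz] : exists2 z, S z & sup S - d < z.
    by apply: sup_gt; [exists 0|rewrite ltrBlDr ltrDl].
  have zs : z <= sup S by exact: ub_le_sup.
  have : H r < hext z by apply: Hd; rewrite /ball/= ger0_norm ?subr_ge0//; lra.
  by case: Sz => _; rewrite leNgt => /negP.
exists (sup S); split; rewrite ?S0s//.
  by move=> x xs; apply: le_trans hs; exact: hext_homo.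
move=> x xs xD; rewrite ltNge; apply/negP => xr.
have : x <= sup S by apply: ub_le_sup => //; split; rewrite ?(le_trans S0s (ltW xs)).
by rewrite leNgt xs.
Qed.

End bellman_slope.

(** * The value function is a viscosity solution *)

Section C1_increments.
Context {R : realType}.
Variables (D : R) (phi dphi : R -> R).
Hypothesis phi_C1 : C1_with_derivative D phi dphi.

Lemma C1_increment x e : 0 <= x <= D -> 0 < e -> exists2 d, 0 < d &
  forall z, 0 <= z <= D -> `|z - x| < d ->
    `|phi z - phi x - dphi x * (z - x)| <= e * `|z - x|.
Proof.
move=> x0D e0; have [_ /(_ x x0D)/cvgrPdist_le/(_ _ e0)] := phi_C1.
rewrite near_withinE => /nbhs_ballP[d /= d0 Hd]; exists d => // z z0D zx.
have [->|zNx] := eqVneq z x; first by rewrite !subrr mulr0 subrr normr0 mulr0.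
have zx0 : z - x != 0 by rewrite subr_eq0.
have := Hd z; rewrite /ball/= distrC => /(_ zx zNx); rewrite in_itv/= => /(_ z0D).
rewrite distrC => Hz.
rewrite (_ : _ - _ = ((phi z - phi x) / (z - x) - dphi x) * (z - x)).
  by rewrite normrM ler_wpM2r.
by rewrite mulrBl divfK.
Qed.

(** A single point close to [x] on the given side is enough to compare the test function with a
    chord of [V]. *)
Lemma C1_increment_left x e d0 : 0 < x <= D -> 0 < e -> 0 < d0 ->
  exists z, [/\ 0 < z, z < x, x - d0 < z &
    `|phi x - phi z - dphi x * (x - z)| <= e * (x - z)].
Proof.
move=> /andP[x0 xD] e0 d00; have [|d dp Hd] := C1_increment (x := x) _ e0.
  by rewrite ltW.
pose m := Num.min x (Num.min d0 d).
have m0 : 0 < m by rewrite !lt_min x0 d00.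
have [mx md0 md] : [/\ m <= x, m <= d0 & m <= d] by rewrite !ge_min !lexx !orbT.
have xz : 0 < m / 2 by rewrite divr_gt0.
exists (x - m / 2); split; [lra|lra|lra|].
have := Hd (x - m / 2); rewrite addrAC subrr sub0r normrN gtr0_norm// => /(_ _ _).
rewrite (_ : x - (x - m / 2) = m / 2); last by ring.
rewrite -normrN; rewrite (_ : - (_ - _) = phi x - phi (x - m / 2) - dphi x * (m / 2)); last by ring.
by apply; lra.
Qed.

Lemma C1_increment_right x e d0 : 0 <= x < D -> 0 < e -> 0 < d0 ->
  exists z, [/\ x < z, z < D, z < x + d0 &
    `|phi z - phi x - dphi x * (z - x)| <= e * (z - x)].
Proof.
move=> /andP[x0 xD] e0 d00; have [|d dp Hd] := C1_increment (x := x) _ e0.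
  by rewrite x0 ltW.
pose m := Num.min (D - x) (Num.min d0 d).
have m0 : 0 < m by rewrite !lt_min subr_gt0 xD d00.
have [mx md0 md] : [/\ m <= D - x, m <= d0 & m <= d] by rewrite !ge_min !lexx !orbT.
have xz : 0 < m / 2 by rewrite divr_gt0.
exists (x + m / 2); split; [lra|lra|lra|].
have := Hd (x + m / 2); rewrite addrAC subrr add0r gtr0_norm//.
by apply; lra.
Qed.

End C1_increments.

Section value_is_viscosity_solution.
Context {R : realType}.
Variables (D r c y : R) (h : R -> R).
Hypothesis gd : bellman_data D r c y h.
Let hr : 0 < r. Proof. by case: gd => -[]. Qed.
Local Notation slope := (slope D r c y h).
Local Notation hext := (hext D h).

(** Only chord bounds are assumed, so that the results apply to [slope_primitive] and to the value
    of the game alike. *)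
Variable V : R -> R.
Hypothesis V0 : V 0 = 0.
Hypothesis V_slope : forall s t, 0 <= s -> s <= t -> t <= D ->
  slope s * (t - s) <= V t - V s <= slope t * (t - s).

(** The chord bounds and [0 <= slope <= r] make [V] Lipschitz with constant [r]. *)
Lemma value_continuous : {within `[0, D], continuous V}.
Proof.
have VL s t : 0 <= s -> s <= t -> t <= D -> `|V t - V s| <= r * (t - s).
  move=> s0 st tD; have /andP[V1 V2] := V_slope s0 st tD.
  rewrite ger0_norm; last by apply: le_trans V1; rewrite mulr_ge0 ?subr_ge0 ?(slope_ge0 gd).
  by apply: le_trans V2 _; rewrite ler_wpM2r ?subr_ge0 ?(slope_ler gd).
apply/within_continuousP => x; rewrite /= in_itv/= => /andP[x0 xD] e e0.
exists (e / r); first by rewrite divr_gt0.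
move=> z; rewrite in_itv/= => /andP[z0 zD]; rewrite ltr_pdivlMr// mulrC => zx.
apply: le_lt_trans zx; have [xz|/ltW zx] := leP x z.
  by rewrite (ger0_norm (_ : 0 <= z - x)) ?subr_ge0// VL.
by rewrite (distrC (V z)) (distrC z) (ger0_norm (_ : 0 <= x - z)) ?subr_ge0// VL.
Qed.

(** A test function touching the convex [V] from above is squeezed by the chords on both sides, so
    its derivative is [slope x]. *)
Lemma value_subsolution : viscosity_subsolution D r c y h `]0, D[ V.
Proof.
split=> [|x phi dphi]; first exact: value_continuous.
rewrite /= in_itv/= => /andP[x0 xD] C1 xmax.
have x0D : 0 <= x <= D by rewrite !ltW.
suff -> : dphi x = slope x.
  rewrite /bellman ge_max !subr_le0 (slope_ler gd)// andbT -(hextE h x0D).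
  exact: (hamiltonian_slope gd).
have xm z : 0 < z -> z < D -> V z - phi z <= V x - phi x.
  by move=> z0 zD; apply: xmax; rewrite /= in_itv/= z0.
apply/eqP; rewrite eq_le; apply/andP; split; apply/ler_addgt0Pr => e e0.
  have [|z [z0 zx _]] := C1_increment_left C1 (x := x) _ e0 (@ltr01 R).
    by rewrite x0 ltW.
  have /andP[_ Vz] := V_slope (ltW z0) (ltW zx) (ltW xD).
  have := xm z z0 (lt_trans zx xD); rewrite ler_norml => Vm /andP[p1 _].
  rewrite -(ler_pM2r (_ : 0 < x - z)) ?subr_gt0// mulrDl; lra.
have [|z [xz zD _]] := C1_increment_right C1 (x := x) _ e0 (@ltr01 R).
  by rewrite xD ltW.
have /andP[Vz _] := V_slope (ltW x0) (ltW xz) (ltW zD).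
have := xm z (lt_trans x0 xz) zD; rewrite ler_norml => Vm /andP[_ p1].
rewrite -(ler_pM2r (_ : 0 < z - x)) ?subr_gt0// mulrDl; lra.
Qed.

(** Only chords to the left of [x] are used, which includes [x = D]; left continuity of the slope
    turns them into [slope x <= dphi x]. *)
Lemma value_supersolution : viscosity_supersolution D r c y h `]0, D] V.
Proof.
split=> [|x phi dphi]; first exact: value_continuous.
rewrite /= in_itv/= => /andP[x0 xD] C1 xmin.
have x0D : 0 <= x <= D by rewrite ltW.
have xm z : 0 < z -> z <= D -> V x - phi x <= V z - phi z.
  by move=> z0 zD; apply: xmin; rewrite /= in_itv/= z0.
suff sx : slope x <= dphi x.
  rewrite /bellman le_max !subr_ge0 -(hextE h x0D).
  have [Hx|->] := slope_super gd sx; last by rewrite orbT.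
  by apply/orP; left; exact: Hx.
apply/ler_addgt0Pr => e e0; have e20 : 0 < e / 2 by rewrite divr_gt0.
have [d d0 Hd] := slope_left_continuous gd x e20.
have [|z [z0 zx xz]] := C1_increment_left C1 (x := x) _ e20 d0.
  by rewrite x0.
have /andP[Vz _] := V_slope (ltW z0) (ltW zx) xD.
have := xm z z0 (le_trans (ltW zx) xD); rewrite ler_norml => Vm /andP[_ p1].
have := Hd z xz (ltW zx); rewrite -(ler_pM2r (_ : 0 < x - z)) ?subr_gt0// => Hz.
rewrite -(ler_pM2r (_ : 0 < x - z)) ?subr_gt0// mulrDl.
by move: Hz; rewrite mulrBl; lra.
Qed.

Lemma value_viscosity_solution : viscosity_solution D r c y h V.
Proof. by split; [exact: value_subsolution|exact: value_supersolution|]. Qed.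

End value_is_viscosity_solution.

(** * Uniqueness of the viscosity solution *)

Section test_function.
Context {R : realType}.

Definition pos_part (z : R) := Num.max 0 z.

(** The middle estimate is a first order expansion: the squared positive part has derivative
    [2 * pos_part u], although the positive part itself is only Lipschitz. *)
Lemma pos_part_bounds (u v : R) :
  0 <= pos_part u /\ `|pos_part v ^+ 2 - pos_part u ^+ 2 - 2 * pos_part u * (v - u)| <=
  (v - u) ^+ 2 /\ `|pos_part v - pos_part u| <= `|v - u|.
Proof.
rewrite /pos_part /Num.max; split; first by case: ifP => // /ltW.
split.
  have u2 := sqr_ge0 u; have v2 := sqr_ge0 v.
  have uv : (0 < u -> v <= 0 -> u * v <= 0) /\ (0 < v -> u <= 0 -> u * v <= 0).
    by split=> *; [rewrite mulr_ge0_le0// ltW|rewrite mulr_le0_ge0// ltW].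
  have := sqr_ge0 (v - u).
  case: ltP => v0; case: ltP => u0; rewrite ler_norml.
  - lra.
  - have := uv.2 v0 u0; lra.
  - have := uv.1 u0 v0; lra.
  - lra.
wlog uv : u v / u <= v.
  by move=> W; have [/W//|/ltW/W] := leP u v; rewrite distrC (distrC u).
rewrite (ger0_norm (_ : 0 <= v - u)) ?subr_ge0// ler_norml.
by do 2 case: ltP => ?; lra.
Qed.

(** [q] is the slope under test, the term in [L] penalizes points beyond [m], and the term in [K],
    which vanishes to first order at [x], localizes the extremum. *)
Definition test (q L m K x z : R) :=
  q * z + L * pos_part (z - m) ^+ 2 + K * (z - x) ^+ 2.
Definition dtest (q L m K x z : R) :=
  q + 2 * L * pos_part (z - m) + 2 * K * (z - x).

Lemma test_C1 D q L m K x : C1_with_derivative D (test q L m K x) (dtest q L m K x).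
Proof.
pose C := `|L| + `|K|.
have C0 : 0 <= C by rewrite addr_ge0.
have C10 : 0 < C + 1 by rewrite ltr_wpDl.
split.
  apply: continuous_subspaceT => u; apply/cvgrPdist_lt => e e0.
  apply/nbhs_ballP; exists (e / (2 * (C + 1))); first by rewrite /= divr_gt0// mulr_gt0.
  move=> v; rewrite /ball/= ltr_pdivlMr ?mulr_gt0// => uv; apply: le_lt_trans uv.
  have [_ [_ uv]] := pos_part_bounds (v - m) (u - m).
  rewrite (_ : u - m - (v - m) = u - v) in uv; last by ring.
  rewrite /dtest (_ : _ - _ = 2 * L * (pos_part (u - m) - pos_part (v - m)) +
    2 * K * (u - v)); last by ring.
  apply: le_trans (ler_normD _ _) _; rewrite !normrM (ger0_norm (_ : 0 <= 2))//.
  have hL := normr_ge0 L; have hK := normr_ge0 K; have hu := normr_ge0 (u - v).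
  have : 2 * `|L| * `|pos_part (u - m) - pos_part (v - m)| <= 2 * `|L| * `|u - v|.
    by rewrite ler_wpM2l// mulr_ge0.
  rewrite /C; lra.
move=> u _; apply/cvgrPdist_le => e e0; rewrite near_withinE.
apply/nbhs_ballP; exists (e / (C + 1)); first by rewrite /= divr_gt0.
move=> v; rewrite /ball/= ltr_pdivlMr// => uv vu _.
have vu0 : v - u != 0 by rewrite subr_eq0.
rewrite -(ler_pM2r (_ : 0 < `|v - u|)) ?normr_gt0// -normrM mulrBl divfK//.
have [_ [H _]] := pos_part_bounds (u - m) (v - m).
rewrite (_ : v - m - (u - m) = v - u) in H; last by ring.
rewrite /test /dtest (_ : _ - _ = - (L * (pos_part (v - m) ^+ 2 - pos_part (u - m) ^+ 2
  - 2 * pos_part (u - m) * (v - u)) + K * (v - u) ^+ 2)); last by ring.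
rewrite normrN; apply: le_trans (ler_normD _ _) _.
rewrite (normrM L) (normrM K) normrX.
apply: (@le_trans _ _ (C * `|v - u| ^+ 2)).
  by rewrite /C [leRHS]mulrDl lerD2r ler_wpM2l// -normrX [leRHS]ger0_norm// sqr_ge0.
rewrite expr2 mulrA ler_pM2r ?normr_gt0// distrC.
apply: le_trans (ltW uv); rewrite mulrC ler_wpM2l// lerDl//.
Qed.

End test_function.

(** * Jets of subsolutions and supersolutions *)

Section jets.
Context {R : realType}.
Variables (D r c y : R) (h : R -> R).
Hypothesis gd : bellman_data D r c y h.
Let hD : 0 < D. Proof. by case: gd => -[]. Qed.
Local Notation H := (hamiltonian c y).
Local Notation slope := (slope D r c y h).
Local Notation hext := (hext D h).
Implicit Types f : R -> R.

Lemma continuous_itv_bounded a b f : a <= b -> {within `[a, b], continuous f} ->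
  exists2 M, 0 < M & forall z, a <= z <= b -> `|f z| <= M.
Proof.
move=> ab cf; have [u _ fu] := EVT_max ab cf; have [v _ fv] := EVT_min ab cf.
exists (`|f u| + `|f v| + 1); first by rewrite ltr_wpDl// addr_ge0.
move=> z zab; have zin : z \in `[a, b] by rewrite in_itv.
have := fu z zin; have := fv z zin.
have := ler_norm (f u); have := ler_norm (- f v); rewrite normrN ler_norml.
have := normr_ge0 (f u); have := normr_ge0 (f v); lra.
Qed.

Lemma pos_part_le (m z : R) : 0 <= m -> 0 <= z -> z <= D -> pos_part (z - m) <= D.
Proof. by move=> m0 z0 zD; rewrite /pos_part ge_max ltW//=; lra. Qed.

(* Adding a large multiple of [(z - x)^2] to the test function turns a local
   extremum at [x] into a global one. *)
Lemma subsolution_jet f q L m x d : viscosity_subsolution D r c y h `]0, D[ f ->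
  0 < x < D -> 0 <= m -> 0 < d ->
  (forall z, 0 < z < D -> `|z - x| < d ->
    f z - q * z - L * pos_part (z - m) ^+ 2 <=
    f x - q * x - L * pos_part (x - m) ^+ 2) ->
  let p := q + 2 * L * pos_part (x - m) in p <= r /\ H p <= hext x.
Proof.
move=> [cf fsub] /andP[x0 xD] m0 d0 xmax p.
have [M M0 fM] := continuous_itv_bounded (ltW hD) cf.
(* [B] bounds the oscillation over [0, D] of [f] minus the rest of the test function, so that at
   distance [d] from [x] the quadratic term outweighs it. *)
pose B := 2 * M + `|q| * D + 2 * `|L| * D ^+ 2.
pose K := B / d ^+ 2.
have Dp := ltW hD; have L0 := normr_ge0 L; have q0 := normr_ge0 q.
have B0 : 0 <= B by rewrite !addr_ge0 ?mulr_ge0 ?exprn_ge0// ltW.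
have K0 : 0 <= K by rewrite divr_ge0// exprn_ge0 ?ltW.
have := fsub x (test q L m K x) (dtest q L m K x) _ (test_C1 _ _ _ _ _ _).
rewrite /dtest subrr mulr0 addr0 -/p => {}fsub.
have : bellman r c y h x p <= 0.
  apply: fsub; first by rewrite /= in_itv/= x0.
  move=> z; rewrite /= in_itv/= => zD; rewrite /test subrr expr0n mulr0 addr0.
  have [zx|zx] := ltP `|z - x| d.
    have := xmax z zD zx; have := mulr_ge0 K0 (sqr_ge0 (z - x)); lra.
  have /andP[/ltW z0 /ltW {}zD] := zD.
  have KB : B <= K * (z - x) ^+ 2.
    rewrite /K mulrAC ler_pdivlMr ?exprn_gt0// ler_wpM2l//.
    by rewrite -(real_normK (num_real (z - x))) ler_pXn2r// ?nnegrE ltW// (lt_le_trans d0).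
  have := fM z; rewrite z0 zD => /(_ isT); rewrite ler_norml => /andP[_ fz].
  have x0D : 0 <= x <= D by rewrite !ltW.
  have := fM x x0D; rewrite ler_norml => /andP[fx _].
  have qz : - (q * (z - x)) <= `|q| * D.
    apply: le_trans (ler_norm _) _; rewrite normrN normrM ler_wpM2l//.
    by rewrite ler_norml; lra.
  have Lz w : 0 <= w -> w <= D -> `|L * pos_part (w - m) ^+ 2| <= `|L| * D ^+ 2.
    move=> w0 wD; have [p0 _] := pos_part_bounds (w - m) 0.
    rewrite (normrM L) normrX (ger0_norm p0) ler_wpM2l//.
    by rewrite ler_pXn2r// ?nnegrE// pos_part_le.
  have := Lz z z0 zD; have := Lz x (ltW x0) (ltW xD); rewrite !ler_norml.
  move: KB; rewrite /B; lra.
have x0D : 0 <= x <= D by rewrite !ltW.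
rewrite /bellman ge_max !subr_le0 -(hextE h x0D) => /andP[h1 ->].
by split.
Qed.

(** For a minimum the quadratic term is subtracted, hence [- K]; here [L = 0], so the jet is [q]
    itself. *)
Lemma supersolution_jet f q x d : viscosity_supersolution D r c y h `]0, D] f ->
  0 < x <= D -> 0 < d ->
  (forall z, 0 < z <= D -> `|z - x| < d -> f x - q * x <= f z - q * z) ->
  hext x <= H q \/ r <= q.
Proof.
move=> [cf fsup] /andP[x0 xD] d0 xmin.
have [M M0 fM] := continuous_itv_bounded (ltW hD) cf.
pose B := 2 * M + `|q| * D.
pose K := B / d ^+ 2.
have Dp := ltW hD; have q0 := normr_ge0 q.
have B0 : 0 <= B by rewrite !addr_ge0 ?mulr_ge0// ltW.
have K0 : 0 <= K by rewrite divr_ge0// exprn_ge0 ?ltW.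
have := fsup x (test q 0 0 (- K) x) (dtest q 0 0 (- K) x) _ (test_C1 _ _ _ _ _ _).
rewrite /dtest subrr !mulr0 mul0r !addr0 => {}fsup.
have : 0 <= bellman r c y h x q.
  apply: fsup; first by rewrite /= in_itv/= x0.
  move=> z; rewrite /= in_itv/= => zD; rewrite /test subrr expr0n !mul0r mulr0 !addr0.
  have [zx|zx] := ltP `|z - x| d.
    have := xmin z zD zx; have := mulr_ge0 K0 (sqr_ge0 (z - x)); lra.
  have /andP[/ltW z0 {}zD] := zD.
  have KB : B <= K * (z - x) ^+ 2.
    rewrite /K mulrAC ler_pdivlMr ?exprn_gt0// ler_wpM2l//.
    by rewrite -(real_normK (num_real (z - x))) ler_pXn2r// ?nnegrE ltW// (lt_le_trans d0).
  have := fM z; rewrite z0 zD => /(_ isT); rewrite ler_norml => /andP[fz _].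
  have x0D : 0 <= x <= D by rewrite ltW.
  have := fM x x0D; rewrite ler_norml => /andP[_ fx].
  have qz : q * (z - x) <= `|q| * D.
    apply: le_trans (ler_norm _) _; rewrite normrM ler_wpM2l//.
    by rewrite ler_norml; lra.
  move: KB; rewrite /B; lra.
have x0D : 0 <= x <= D by rewrite ltW.
rewrite /bellman le_max !subr_ge0 -(hextE h x0D).
by move=> /orP[?|?]; [left|right].
Qed.

End jets.

(** * Comparison of solutions with the slope *)

Section uniqueness.
Context {R : realType}.
Variables (D r c y : R) (h : R -> R).
Hypothesis gd : bellman_data D r c y h.
Let hr : 0 < r. Proof. by case: gd => -[]. Qed.
Let hc : 0 < c. Proof. by case: gd => -[]. Qed.
Let h_incr u v : 0 <= u -> u < v -> v <= D -> h u < h v.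
Proof. by case: gd => _ [_ + _ _]; apply. Qed.
Local Notation H := (hamiltonian c y).
Local Notation slope := (slope D r c y h).
Local Notation hext := (hext D h).
Implicit Types f : R -> R.

Lemma pos_part_continuous : continuous (@pos_part R).
Proof.
move=> u; apply/cvgrPdist_lt => e e0; apply/nbhs_ballP; exists e => // v uv.
by have [_ [_ /le_lt_trans]] := pos_part_bounds v u; apply.
Qed.

Lemma within_continuous_itvS a b a' b' f : a' <= a -> b <= b' ->
  {within `[a', b'], continuous f} -> {within `[a, b], continuous f}.
Proof.
move=> aa bb; apply: continuous_subspaceW => x /=; rewrite !in_itv/=.
by move=> /andP[ax xb]; rewrite (le_trans aa ax) (le_trans xb bb).
Qed.

(** If the chord were steeper than [q], the tilted function [f - q z], once penalized near [b],
    would have an interior maximum with a jet [p >= q], which the last hypothesis excludes. *)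
Lemma subsolution_increment f q a b : viscosity_subsolution D r c y h `]0, D[ f ->
  0 <= a -> a <= b -> b <= D ->
  (forall x p, a < x -> x < b -> q <= p -> p <= r -> H p <= hext x -> False) ->
  f b - f a <= q * (b - a).
Proof.
move=> fsub a0; rewrite le_eqVlt => /predU1P[-> bD|ab bD Hq].
  by rewrite !subrr mulr0.
rewrite leNgt; apply/negP => qf.
pose G z := f z - q * z.
have cf := within_continuous_itvS a0 bD fsub.1.
have Gab : 0 < G b - G a by rewrite /G; lra.
have cG : {within `[a, b], continuous G}.
  move=> z; apply: cvgB; first exact: cf.
  by apply: continuous_subspaceT => u; apply: cvgM; [exact: cvg_cst|exact: cvg_id].
(* By continuity, a point [m] close enough to [b] still has a value above [G a]. *)
have [m /andP[am mb] Gm] : exists2 m, a < m < b & G a < G m.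
  have /within_continuousP/(_ b _ _ Gab)[|d d0 Hd] := cG.
    by rewrite /= in_itv/= lexx ltW.
  pose k := Num.min (b - a) d / 2.
  have k0 : 0 < Num.min (b - a) d by rewrite lt_min subr_gt0 ab.
  have [k1 k2] : Num.min (b - a) d <= b - a /\ Num.min (b - a) d <= d.
    by rewrite !ge_min !lexx orbT.
  exists (b - k); first by rewrite /k; apply/andP; split; lra.
  have := Hd (b - k); rewrite /= in_itv/= addrAC subrr sub0r normrN.
  rewrite ger0_norm; last by rewrite /k; lra.
  by rewrite /k ltr_norml => /(_ _ _)/andP[||]; lra.
(* The penalty [L (z - m)_+^2] keeps the maximum away from [b] without lowering
   the slope of the test function below [q]. *)
pose L := `|G b - G m| / (b - m) ^+ 2 + 1.
have bm0 : 0 < (b - m) ^+ 2 by rewrite exprn_gt0// subr_gt0.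
have L0 : 0 < L by rewrite ltr_pwDr// divr_ge0// ltW.
pose W z := G z - L * pos_part (z - m) ^+ 2.
have Wm_ : W m = G m.
  by rewrite /W /pos_part subrr max_l// expr0n mulr0 subr0.
have Wb : W b < W m.
  rewrite Wm_ /W /pos_part max_r; last by rewrite subr_ge0 ltW.
  rewrite /L mulrDl divfK ?gt_eqF// mul1r.
  have := ler_norm (G b - G m); lra.
have Wa : W a < W m.
  rewrite Wm_ /W /pos_part max_l; last by rewrite subr_le0 ltW.
  by rewrite expr0n mulr0 subr0.
have cW : {within `[a, b], continuous W}.
  have cL : continuous (fun z => L * pos_part (z - m) ^+ 2).
    move=> u; apply: cvgM; first exact: cvg_cst.
    have cp : pos_part (v - m) @[v --> u] --> pos_part (u - m).
      apply: (cvg_comp (fun v => v - m) (@pos_part R)); last exact: pos_part_continuous.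
      by apply: cvgB; [exact: cvg_id|exact: cvg_cst].
    by rewrite expr2; apply: cvgM.
  by move=> z; apply: cvgB; [exact: cG|exact: (continuous_subspaceT cL)].
have [x] := EVT_max (ltW ab) cW; rewrite in_itv/= => /andP[ax xb] xmax.
have Wm : W m <= W x by apply: xmax; rewrite in_itv/= !ltW.
have {}ax : a < x.
  by rewrite lt_neqAle ax andbT; apply/eqP => ax'; move: Wm; rewrite -ax' leNgt Wa.
have {}xb : x < b.
  by rewrite lt_neqAle xb andbT; apply/eqP => xb'; move: Wm; rewrite xb' leNgt Wb.
have m0 : 0 <= m by apply: le_trans a0 (ltW am).
have d0 : 0 < Num.min (x - a) (b - x) by rewrite lt_min !subr_gt0 ax.
have [||p1 p2] := subsolution_jet gd (q := q) (L := L) (x := x) fsub _ m0 d0.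
- by rewrite (le_lt_trans a0 ax) (lt_le_trans xb bD).
- move=> z /andP[z0 zD]; rewrite lt_min !ltr_norml => /andP[/andP[za _] /andP[_ zb]].
  by apply: xmax; rewrite in_itv/=; apply/andP; split; lra.
apply: (Hq x _ ax xb _ p1 p2); rewrite lerDl.
apply: mulr_ge0; first by rewrite mulr_ge0// ltW.
by have [] := pos_part_bounds (x - m) 0.
Qed.

(** The minimum is taken over [a, D] instead of [a, b]: the supersolution property holds at [D],
    whereas a minimum at an end [b < D] of a smaller interval would carry no information. *)
Lemma supersolution_increment f q a b : viscosity_supersolution D r c y h `]0, D] f ->
  0 <= a -> a <= b -> b <= D ->
  (forall x, a < x -> x <= D -> hext x <= H q \/ r <= q -> False) ->
  q * (b - a) <= f b - f a.
Proof.
move=> fsup a0 ab bD Hq; rewrite leNgt; apply/negP => qf.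
pose G z := f z - q * z.
have aD := le_trans ab bD.
have cf := within_continuous_itvS a0 (lexx D) fsup.1.
have Gab : G b < G a by rewrite /G; lra.
have cG : {within `[a, D], continuous G}.
  move=> z; apply: cvgB; first exact: cf.
  by apply: continuous_subspaceT => u; apply: cvgM; [exact: cvg_cst|exact: cvg_id].
have [x] := EVT_min aD cG; rewrite in_itv/= => /andP[ax xD] xmin.
have Gx : G x <= G b by apply: xmin; rewrite in_itv/= ab.
have {}ax : a < x.
  rewrite lt_neqAle ax andbT; apply/eqP => ax'; move: Gx.
  by rewrite -ax' leNgt Gab.
have d0 : 0 < x - a by rewrite subr_gt0.
apply: (Hq x ax xD); apply: (supersolution_jet gd fsup _ d0).
  by rewrite (le_lt_trans a0 ax).
move=> z /andP[z0 zD]; rewrite ltr_norml => /andP[za _].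
by apply: xmin; rewrite in_itv/= zD andbT; lra.
Qed.

Lemma subsolution_increment_r f a b : viscosity_subsolution D r c y h `]0, D[ f ->
  0 <= a -> a <= b -> b <= D -> f b - f a <= r * (b - a).
Proof.
move=> fsub a0 ab bD; apply/ler_addgt0Pr => e e0.
have ba : 0 < b - a + 1 by rewrite ltr_pwDr// subr_ge0.
apply: (@le_trans _ _ ((r + e / (b - a + 1)) * (b - a))).
  apply: subsolution_increment => // x p _ _ qp pr _.
  have : 0 < e / (b - a + 1) by rewrite divr_gt0.
  lra.
rewrite mulrDl lerD2l mulrAC ler_pdivrMr// ler_pM2l//; lra.
Qed.

(** As [h] is strictly increasing, each [x < b] satisfies [hext x < H r], and there [sub_slope_le]
    bounds every jet by [slope b]. *)
Lemma subsolution_increment_slope f a b : viscosity_subsolution D r c y h `]0, D[ f ->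
  0 <= a -> a <= b -> b <= D -> hext b <= H r -> f b - f a <= slope b * (b - a).
Proof.
move=> fsub a0 ab bD br; apply/ler_addgt0Pr => e e0.
have ba : 0 < b - a + 1 by rewrite ltr_pwDr// subr_ge0.
apply: (@le_trans _ _ ((slope b + e / (b - a + 1)) * (b - a))).
  apply: subsolution_increment => // x p ax xb qp pr px.
  have e'0 : 0 < e / (b - a + 1) by rewrite divr_gt0.
  have x0 : 0 <= x by apply: le_trans a0 (ltW ax).
  have xr : hext x < H r.
    apply: lt_le_trans br; rewrite !hextE ?x0 ?bD ?(le_trans a0 ab) ?(le_trans (ltW xb))//.
    exact: h_incr.
  have := sub_slope_le gd xr pr px; have := slope_homo gd (ltW xb); lra.
rewrite mulrDl lerD2l mulrAC ler_pdivrMr// ler_pM2l//; lra.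
Qed.

Lemma supersolution_increment_slope f a b :
  viscosity_supersolution D r c y h `]0, D] f ->
  0 <= a -> a <= b -> b <= D -> slope a * (b - a) <= f b - f a.
Proof.
move=> fsup a0 ab bD; apply/ler_addgt0Pr => e e0.
have ba : 0 < b - a + 1 by rewrite ltr_pwDr// subr_ge0.
have e'0 : 0 < e / (b - a + 1) by rewrite divr_gt0.
have aD := le_trans ab bD.
have [k [k0 ke Hk]] : exists k, [/\ 0 < k, k <= e / (b - a + 1) &
    H (slope a - k) < hext a].
  have [ar|ra] := leP (hext a) (H r).
    exists (e / (b - a + 1)); split => //.
    rewrite -(hamiltonian_slope_low gd ar) (hamiltonian_lt gd) ?gtrBl//.
    exact: slope_low_vertex.
  rewrite (slope_high ra).
  (* [M] exceeds the modulus of the derivative of [H] at [r]. As the second order term is negative,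
     [H (r - k) < H r + k * M]. *)
  pose M := `|- y - r / (2 * c)| + 1 + r / (4 * c).
  have M0 : 0 < M.
    by rewrite /M ltr_wpDr ?divr_ge0 ?mulr_ge0 ?ltW// ltr_wpDl.
  have hM : 0 < (hext a - H r) / M by rewrite divr_gt0// subr_gt0.
  pose k := Num.min (e / (b - a + 1)) ((hext a - H r) / M / 2).
  have k0 : 0 < k by rewrite lt_min e'0 divr_gt0.
  exists k; split => //; first by rewrite ge_min lexx.
  have kM : k * M < hext a - H r.
    rewrite -ltr_pdivlMr//; apply: (@le_lt_trans _ _ ((hext a - H r) / M / 2)).
      by rewrite ge_min lexx orbT.
    by rewrite ltr_pdivrMr// ltr_pMr// ltr1n.
  apply: (@le_lt_trans _ _ (H r + k * `|- y - r / (2 * c)|)).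
    rewrite (_ : H (r - k) = H r - k * (- y - r / (2 * c)) - k ^+ 2 / (4 * c)).
      have := ler_norm (- (- y - r / (2 * c))); rewrite normrN.
      rewrite -(ler_pM2l k0) mulrN.
      have : 0 <= k ^+ 2 / (4 * c) by rewrite divr_ge0 ?sqr_ge0// mulr_ge0// ltW.
      lra.
    by rewrite !(hamiltonianE gd); field; rewrite gt_eqF.
  have : 0 < k * (1 + r / (4 * c)).
    by rewrite mulr_gt0// ltr_wpDr// divr_ge0 ?mulr_ge0 ?ltW.
  move: kM; rewrite /M; lra.
rewrite -lerBlDr; apply: (@le_trans _ _ ((slope a - k) * (b - a))).
  rewrite mulrBl lerD2l lerN2.
  apply: (@le_trans _ _ (e / (b - a + 1) * (b - a))).
    by rewrite ler_wpM2r// subr_ge0.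
  rewrite mulrAC ler_pdivrMr// ler_pM2l//; lra.
apply: supersolution_increment => // x ax xD [xq|rq].
  by have := le_trans (hext_homo gd (ltW ax)) xq; rewrite leNgt Hk.
by have := slope_ler gd a; lra.
Qed.

Variable V : R -> R.
Hypothesis V0 : V 0 = 0.
Hypothesis V_slope : forall s t, 0 <= s -> s <= t -> t <= D ->
  slope s * (t - s) <= V t - V s <= slope t * (t - s).

(** Up to [xs] the slope coincides with the continuous [minus_root]. *)
Lemma slope_small_oscillation x e xs : hext xs <= H r -> 0 < e -> x <= xs ->
  exists2 d, 0 < d & forall s t, x - d < s -> s <= t -> t < x + d -> t <= xs ->
    slope t - slope s <= e.
Proof.
move=> xsr e0 xxs; have e20 : 0 < e / 2 by rewrite divr_gt0.
have /cvgrPdist_lt/(_ _ e20)/nbhs_ballP[d /= d0 Hd] := @minus_root_continuous _ _ _ _ _ _ gd x.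
exists d => // s t xs' st tx txs.
have tr : hext t <= H r by exact: le_trans (hext_homo gd txs) xsr.
have sr : hext s <= H r by exact: le_trans (hext_homo gd st) tr.
rewrite !slope_low//.
have Hb z : x - d < z -> z < x + d -> `|minus_root D c y h x - minus_root D c y h z| < e / 2.
  by move=> z1 z2; apply: Hd; rewrite /ball/= ltr_norml; apply/andP; split; lra.
have := Hb s xs' (le_lt_trans st tx); have := Hb t (lt_le_trans xs' st) tx.
rewrite !ltr_norml; lra.
Qed.

(** Needed at [xs]: the slope equals [r] only strictly above it, so estimates start at [s > xs] and
    pass to the limit. *)
Lemma right_limit_le (G : R -> R) a b : {within `[0, D], continuous G} ->
  0 <= a -> a <= b -> b <= D -> (forall s, a < s -> s <= b -> G b <= G s) ->
  G b <= G a.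
Proof.
move=> cG a0; rewrite le_eqVlt => /predU1P[-> //|ab bD Hs].
apply/ler_addgt0Pr => e e0.
have /within_continuousP/(_ a _ _ e0)[|d d0 Hd] := cG.
  by rewrite /= in_itv/= a0 (le_trans (ltW ab)).
pose k := Num.min (b - a) d.
have k0 : 0 < k by rewrite lt_min subr_gt0 ab.
have [k1 k2] : k <= b - a /\ k <= d by rewrite !ge_min !lexx orbT.
have h1 : G b <= G (a + k / 2) by apply: Hs; lra.
have : `|G (a + k / 2) - G a| < e.
  apply: Hd; first by rewrite /= in_itv/=; apply/andP; split; lra.
  by rewrite addrAC subrr add0r ger0_norm; lra.
by rewrite ltr_norml; lra.
Qed.

Theorem viscosity_solution_unique f x : viscosity_solution D r c y h f ->
  0 <= x <= D -> f x = V x.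
Proof.
move=> [fsub fsup f0] /andP[x0 xD].
have [xs [/andP[xs0 xsD] xsr low high]] := switch_level gd.
have cV := value_continuous gd V_slope.
(* Since the slope is continuous up to [xs], increments bounded by [(slope t - slope s) * (t - s)]
   are of smaller order than [t - s]. *)
have incr (F : R -> R) z : 0 <= z -> z <= xs -> F 0 = 0 ->
    (forall s t, 0 <= s -> s <= t -> t <= xs ->
      F t - F s <= (slope t - slope s) * (t - s)) -> F z <= 0.
  move=> z0 zxs F0 HF; rewrite -F0; apply: le_of_small_increments => // u e /andP[u0 uz] e0.
  have [d d0 Hd] := slope_small_oscillation xsr e0 (le_trans uz zxs).
  exists d => // s t s0 us st tu tz _.
  apply: le_trans (HF s t s0 st (le_trans tz zxs)) _.
  by rewrite ler_wpM2r ?subr_ge0// Hd// (le_trans tz).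
have eqlow z : 0 <= z -> z <= xs -> f z = V z.
  move=> z0 zxs; apply/eqP; rewrite eq_le; apply/andP; split; rewrite -subr_le0.
    apply: (incr (fun z => f z - V z)) => //; first by rewrite f0 V0 subrr.
    move=> s t s0 st txs; have tD := le_trans txs xsD.
    have := subsolution_increment_slope fsub s0 st tD (low _ txs).
    by have := V_slope s0 st tD; rewrite mulrBl; lra.
  apply: (incr (fun z => V z - f z)) => //; first by rewrite f0 V0 subrr.
  move=> s t s0 st txs; have tD := le_trans txs xsD.
  have := supersolution_increment_slope fsup s0 st tD.
  by have := V_slope s0 st tD; rewrite mulrBl; lra.
have [xxs|/ltW xxs] := leP x xs; first exact: eqlow.
have E := eqlow xs xs0 (lexx _).
have cB (F G : R -> R) : {within `[0, D], continuous F} ->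
    {within `[0, D], continuous G} -> {within `[0, D], continuous (fun z => F z - G z)}.
  by move=> cF cG z; apply: cvgB; [exact: cF|exact: cG].
(* Above [xs] both functions have slope exactly [r], so their difference keeps the value 0 that it
   has at [xs]. *)
apply/eqP; rewrite eq_le; apply/andP; split.
  suff : f x - V x <= f xs - V xs by rewrite E subrr subr_le0.
  apply: (right_limit_le (G := fun z => f z - V z)) => //; first exact: cB fsub.1 cV.
  move=> s xss sx; have s0 := le_trans xs0 (ltW xss).
  have := subsolution_increment_r fsub s0 sx xD.
  have := V_slope s0 sx xD; rewrite (slope_high (x := s)) ?high ?(le_trans sx)//; lra.
suff : V x - f x <= V xs - f xs by rewrite E subrr subr_le0.
apply: (right_limit_le (G := fun z => V z - f z)) => //; first exact: cB cV fsub.1.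
move=> s xss sx; have s0 := le_trans xs0 (ltW xss).
have := supersolution_increment_slope fsup s0 sx xD.
have := V_slope s0 sx xD; rewrite (slope_high (x := s)) ?high ?(le_trans sx)//.
have xs0' : 0 <= x - s by rewrite subr_ge0.
by have := ler_wpM2r xs0' (slope_ler gd x); lra.
Qed.

End uniqueness.

(** * The energy of an absolutely continuous path *)

Section energy.
Context {R : realType}.
Notation mu := (@lebesgue_measure R).

(* The larger function need not be measurable: the integral of a nonnegative
   function is a supremum over the simple functions below it. *)
Lemma ge0_le_integral_nonmeasurable d (T : measurableType d)
    (m : {measure set T -> \bar R}) (A : set T) (f g : T -> \bar R) :
  (forall x, A x -> (0 <= f x)%E) -> (forall x, A x -> (f x <= g x)%E) ->
  (\int[m]_(x in A) f x <= \int[m]_(x in A) g x)%E.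
Proof.
move=> f0 fg; have g0 x : A x -> (0 <= g x)%E.
  by move=> Ax; rewrite (le_trans (f0 x Ax))// fg.
rewrite integral_mkcond [leRHS]integral_mkcond.
rewrite !ge0_integralTE; try exact: erestrict_ge0.
apply: le_ereal_sup => _ [k kf <-]; exists k => // x.
by apply: le_trans (kf x) _; apply: lee_restrict.
Qed.

Lemma energy_ge0 (c1 c2 T : R) psi : 0 <= c1 -> 0 <= c2 ->
  (0 <= energy c1 c2 T psi)%E.
Proof.
move=> c10 c20; rewrite /energy; case: ifP => _ //.
by apply: integral_ge0 => s _; rewrite lee_fin addr_ge0// mulr_ge0// sqr_ge0.
Qed.

(** [k] is the energy density, with measurable densities in place of the pointwise derivatives. The
    last clause integrates Young's inequality, applied with momentum [p] to the first control and
    [- p] to the second. *)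
Lemma abs_continuous_energy (c1 c2 T : R) psi : 0 < c1 -> 0 < c2 -> 0 < T ->
  path2 psi -> abs_continuous 0 T psi.1 -> abs_continuous 0 T psi.2 ->
  exists k : R -> R, [/\ measurable_fun setT k, forall t, 0 <= k t,
    (\int[mu]_(t in `[0%R, T]) (k t)%:E <= energy c1 c2 T psi)%E &
    forall p s t, 0 <= s -> s <= t -> t <= T ->
      mu.-integrable `]s, t] (EFin \o k) ->
      p * ((psi.1 t - psi.2 t) - (psi.1 s - psi.2 s)) -
        p ^+ 2 / (4 * (c1^-1 + c2^-1)^-1) * (t - s) <=
      \int[mu]_(u in `]s, t]) k u].
Proof.
move=> c10 c20 T0 [[cpsi1 _] [cpsi2 _]] ac1 ac2.
have cS (f : R -> R) : {within `[0, +oo[, continuous f} -> {within `[0, T], continuous f}.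
  by apply: continuous_subspaceW => x /=; rewrite !in_itv/= => /andP[-> _].
have [g1 ig1 [g1E g1ae]] := abs_continuous_FTC T0 (cS _ cpsi1) ac1.
have [g2 ig2 [g2E g2ae]] := abs_continuous_FTC T0 (cS _ cpsi2) ac2.
have mg1 : measurable_fun setT g1 by apply/measurable_EFinP; exact: measurable_int ig1.
have mg2 : measurable_fun setT g2 by apply/measurable_EFinP; exact: measurable_int ig2.
pose k t := c1 * g1 t ^+ 2 + c2 * g2 t ^+ 2.
have mk : measurable_fun setT k.
  by apply: measurable_funD; apply: measurable_funM => //; exact: measurable_funX.
have k0 t : 0 <= k t by rewrite addr_ge0// mulr_ge0 ?sqr_ge0// ltW.
exists k; split => //.
  rewrite /energy asboolT//.
  have [N [mN N0 NE]] : {ae mu, forall x, 0 < x < T ->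
      derive1 psi.1 x = g1 x /\ derive1 psi.2 x = g2 x}.
    move: g1ae g2ae; apply: filterS2; first exact: (ae_filter_ringOfSetsType mu).
    by move=> x h1 h2 x0T; split; [exact: h1|exact: h2].
  pose E := `]0, T[%classic `\` N.
  (* [k'] vanishes wherever the derivatives may differ from the densities. Hence it lies below the
     integrand of the energy at every point, and it has the same integral as [k]. *)
  pose k' t := if t \in E then (k t)%:E else 0%E.
  have mE : measurable E by apply: measurableD => //; exact: measurable_itv.
  have mkE : measurable_fun setT (EFin \o k) by exact/measurable_EFinP.
  have mk' : measurable_fun setT k'.
    apply: measurable_fun_ifT; [|exact: mkE|exact: measurable_cst].
    by apply: (measurable_fun_bool true); rewrite setTI preimage_mem_true.
  have k'0 t : (0 <= k' t)%E by rewrite /k'; case: ifP => _ //; rewrite lee_fin.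
  rewrite (_ : (\int[mu]_(t in `[0%R, T]) (k t)%:E = \int[mu]_(t in `[0%R, T]) k' t)%E).
    apply: ge0_le_integral_nonmeasurable => // t _; rewrite /k'.
    case: ifPn => [|_]; last first.
      by rewrite lee_fin addr_ge0// mulr_ge0 ?sqr_ge0// ltW.
    rewrite inE => -[] /=; rewrite in_itv/= => t0T Nt; rewrite lee_fin /k.
    suff [-> ->] : derive1 psi.1 t = g1 t /\ derive1 psi.2 t = g2 t by [].
    by apply: contrapT => Ht; apply: Nt; apply: NE => /= /(_ t0T).
  apply: ge0_ae_eq_integral.
  - exact: measurable_itv.
  - exact: measurable_funTS mkE.
  - exact: measurable_funTS.
  - by move=> t _; rewrite lee_fin.
  - by move=> t _.
  - exists (N `|` [set 0; T]); split.
    + by apply: measurableU => //; apply: measurableU; exact: measurable_set1.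
    + have m2 : mu [set 0; T] = 0%E.
        exact/countable_lebesgue_measure0/finite_set_countable/finite_set2.
      have mm : measurable ([set 0; T] : set R).
        by apply: measurableU; exact: measurable_set1.
      have : (mu (N `|` [set 0%R; T]) <= mu N + mu [set 0%R; T])%E by exact: (@measureU2 _ _ _ mu N [set 0; T] mN mm).
      by rewrite N0 m2 adde0 measure_le0 => /eqP.
    + move=> t /=; apply: contra_notP => /not_orP[Nt /not_orP[t0 tT]].
      rewrite in_itv/= => /andP[tge0 tleT]; rewrite /k' ifT// inE; split => //=.
      rewrite in_itv/= !lt_neqAle tge0 tleT !andbT; apply/andP; split; apply/eqP => //.
      by move=> /esym.
move=> p s t s0 st tT ik.
have mst : measurable (`]s, t]%classic : set (measurableTypeR R)).
  exact: measurable_itv.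
have igS (g : R -> R) : mu.-integrable setT (EFin \o g) -> mu.-integrable `]s, t] (EFin \o g).
  by move=> ig; apply: integrableS ig.
have iZ (g : R -> R) a : mu.-integrable setT (EFin \o g) ->
    mu.-integrable `]s, t] (EFin \o (fun x => a * g x)).
  by move=> ig; apply: eq_integrable (integrableZl mst a (igS _ ig)).
rewrite (_ : p * _ - _ = \int[mu]_(u in `]s, t])
   ((p * g1 u - p * g2 u) - p ^+ 2 / (4 * (c1^-1 + c2^-1)^-1))); last first.
  rewrite RintegralB//; last 2 first.
    by apply: eq_integrable (integrableB mst (iZ _ p ig1) (iZ _ p ig2)) => //.
    exact: cst_itv_integrable.
  rewrite RintegralB// ?RintegralZl//; try exact: iZ; try exact: igS;
    try exact: cst_itv_integrable.
  by rewrite -g1E// -g2E// Rintegral_itv_cst//; ring.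
apply: (le_Rintegral mst _ ik).
  apply: eq_integrable (integrableB mst (integrableB mst (iZ _ p ig1) (iZ _ p ig2))
    (cst_itv_integrable s t false false (p ^+ 2 / (4 * (c1^-1 + c2^-1)^-1)))) => //.
move=> u _; rewrite /k.
have -> : p ^+ 2 / (4 * (c1^-1 + c2^-1)^-1) = p ^+ 2 / (4 * c1) + p ^+ 2 / (4 * c2).
  by field; rewrite !gt_eqF// addr_gt0.
have sq (d a b : R) : 0 < d -> b * a - b ^+ 2 / (4 * d) <= d * a ^+ 2.
  move=> d0; rewrite -subr_ge0 (_ : _ - _ = (2 * d * a - b) ^+ 2 / (4 * d)).
    by rewrite divr_ge0 ?sqr_ge0// mulr_ge0// ltW.
  by field; rewrite gt_eqF.
have := sq c1 (g1 u) p c10; have := sq c2 (g2 u) (- p) c20.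
by rewrite sqrrN mulNr; lra.
Qed.

End energy.

(** * Hitting times and reflection *)

Section hitting.
Context {R : realType}.

(** The infimum is approached from above, so closedness from the right suffices; right-continuous
    controls offer exactly that. *)
Lemma inf_attained (S : set R) : S !=set0 -> has_lbound S ->
  (forall t, lbound S t -> ~ S t -> exists2 d, 0 < d & forall s, t < s -> s < t + d -> ~ S s) ->
  S (inf S).
Proof.
move=> S0 lS H; apply: contrapT => nS.
have [d d0 Hd] := H _ (fun x Sx => ge_inf lS Sx) nS.
have [s Ss si] : exists2 s, S s & s < inf S + d by apply: inf_lt => //; rewrite ltrDl.
have := ge_inf lS Ss; rewrite le_eqVlt => /predU1P[E|si']; first by apply: nS; rewrite E.
exact: Hd Ss.
Qed.

Lemma within_itvcy_right (f : R -> R) t e : {within `[0, +oo[, continuous f} ->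
  0 <= t -> 0 < e -> exists2 d, 0 < d &
    forall s, t <= s -> s < t + d -> `|f s - f t| < e.
Proof.
move=> /within_continuousP cf t0 e0.
have [|d d0 Hd] := cf t _ _ e0; first by rewrite /= in_itv/= t0.
exists d => // s ts sd; apply: Hd; first by rewrite /= in_itv/= (le_trans t0 ts).
by rewrite ger0_norm ?subr_ge0//; lra.
Qed.

Lemma at_right_control (rho : R -> R) t e : is_control rho -> 0 <= t -> 0 < e ->
  exists2 d, 0 < d & forall s, t <= s -> s < t + d -> `|rho s - rho t| < e.
Proof.
move=> [_ _ rr _] t0 e0; have /cvgrPdist_lt/(_ _ e0) := rr t t0.
rewrite near_withinE => /nbhs_ballP[d /= d0 Hd]; exists d => // s.
rewrite le_eqVlt => /predU1P[<- _|ts sd]; first by rewrite subrr normr0.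
rewrite distrC; apply: Hd => //; rewrite /ball/= distrC ger0_norm ?subr_ge0; lra.
Qed.

Lemma dynamics_right (y x : R) psi rho t e : path2 psi -> is_control rho ->
  0 <= t -> 0 < e ->
  exists2 d, 0 < d & forall s, t <= s -> s < t + d ->
    `|dynamics y x psi rho s - dynamics y x psi rho t| < e.
Proof.
move=> [[c1 _] [c2 _]] cr t0 e0; have e40 : 0 < e / 4 by rewrite divr_gt0.
have [d1 d10 H1] := within_itvcy_right c1 t0 e40.
have [d2 d20 H2] := within_itvcy_right c2 t0 e40.
have [d3 d30 H3] := at_right_control cr t0 e40.
have Y0 : 0 < `|y| + 1 by rewrite ltr_wpDl.
pose d4 := e / 4 / (`|y| + 1).
have d40 : 0 < d4 by rewrite divr_gt0.
exists (Num.min (Num.min d1 d2) (Num.min d3 d4)); first by rewrite !lt_min d10 d20 d30.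
move=> s ts; rewrite -ltrBlDl !lt_min => /andP[/andP[s1 s2] /andP[s3 s4]].
have := H1 s ts; have := H2 s ts; have := H3 s ts; rewrite -!ltrBlDl.
move=> /(_ s3) h3 /(_ s2) h2 /(_ s1) h1.
have h4 : `|y * (s - t)| <= e / 4.
  rewrite normrM (ger0_norm (_ : 0 <= s - t)) ?subr_ge0//.
  move: s4; rewrite /d4 ltr_pdivlMr// => s4.
  have : 0 <= s - t by rewrite subr_ge0.
  by move: s4; lra.
rewrite /dynamics; move: h1 h2 h3 h4; rewrite !ltr_norml ler_norml; lra.
Qed.

(** Right continuity of the dynamics makes the infimum attained. *)
Lemma hitting_timeP (y x : R) psi rho : path2 psi -> is_control rho ->
  (hitting_time y x psi rho < +oo)%E ->
  exists T, [/\ 0 <= T, hitting_time y x psi rho = T%:E,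
    dynamics y x psi rho T = 0 &
    forall t, 0 <= t -> t < T -> dynamics y x psi rho t != 0].
Proof.
move=> ppsi cr; rewrite /hitting_time; set S := [set t | _] => Hfin.
have S0 : S !=set0.
  apply: contrapT => /set0P/negP; rewrite negbK => /eqP E.
  by move: Hfin; rewrite E image_set0 ereal_inf0 ltxx.
have lS : has_lbound S by exists 0 => t [].
exists (inf S); split.
- by apply: lb_le_inf => // t [].
- by rewrite ereal_inf_EFin.
- suff [] : S (inf S) by [].
  apply: inf_attained => // t tS nS.
  have [t0|t0] := ltP t 0.
    by exists (- t) => [|s _]; [rewrite oppr_gt0|rewrite subrr => s0 [/le_lt_trans/(_ s0)]; rewrite ltxx].
  have dt : 0 < `|dynamics y x psi rho t|.
    by rewrite normr_gt0; apply/eqP => E; apply: nS.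
  have [d d0 Hd] := dynamics_right y x ppsi cr t0 dt.
  exists d => // s ts sd [_ E]; have := Hd s (ltW ts) sd.
  by rewrite E sub0r normrN ltxx.
- move=> t t0 tS; apply/eqP => E; move: tS; rewrite ltNge => /negP; apply.
  by apply: ge_inf.
Qed.

Lemma hitting_time_le (y x t : R) psi rho : 0 <= t -> dynamics y x psi rho t = 0 ->
  (hitting_time y x psi rho <= t%:E)%E.
Proof. by move=> t0 E; apply: ereal_inf_lbound; exists t. Qed.

Lemma le_hitting_time (y x t : R) psi rho :
  (forall s, 0 <= s -> s < t -> dynamics y x psi rho s != 0) ->
  (t%:E <= hitting_time y x psi rho)%E.
Proof.
move=> H; apply: le_ereal_inf_tmp => _ [s [s0 E] <-]; rewrite lee_fin leNgt.
by apply/negP => /(H s s0); rewrite E eqxx.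
Qed.

End hitting.

(** * Skorokhod reflection at an upper barrier *)

Section reflection.
Context {R : realType}.
Variables (l : R) (z : R -> R).

(** The Skorokhod control for the barrier [l]: the running maximum of the excess of [z] over [l]. *)
Definition reflection t := sup [set pos_part (z s - l) | s in `[0, t]].

Hypothesis cz : {within `[0, +oo[, continuous z}.

Lemma reflectionP t : 0 <= t -> exists u, [/\ 0 <= u <= t,
  reflection t = pos_part (z u - l) &
  forall s, 0 <= s -> s <= t -> pos_part (z s - l) <= reflection t].
Proof.
move=> t0.
have cp : {within `[0, t], continuous (fun s => pos_part (z s - l))}.
  apply/within_continuousP => s; rewrite /= in_itv/= => /andP[s0 st] e e0.
  have [|d d0 Hd] := (within_continuousP _ _).1 cz s _ e e0.
    by rewrite /= in_itv/= s0.
  exists d => // v; rewrite /= in_itv/= => /andP[v0 vt] vs.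
  have [_ [_]] := pos_part_bounds (z s - l) (z v - l) => /le_lt_trans; apply.
  by rewrite (_ : _ - _ = z v - z s); [apply: Hd; rewrite //= in_itv/= v0|ring].
have [u] := EVT_max t0 cp; rewrite in_itv/= => ut umax.
exists u; suff E : reflection t = pos_part (z u - l).
  by split => // s s0 st; rewrite E; apply: umax; rewrite in_itv/= s0.
have [u0 ut'] := andP ut.
apply/eqP; rewrite eq_le; apply/andP; split.
  apply: ge_sup; first by exists (pos_part (z u - l)), u => //=; rewrite in_itv.
  by move=> _ [s + <-]; exact: umax.
apply: ub_le_sup; last by exists u => //=; rewrite in_itv.
by exists (pos_part (z u - l)) => _ [s + <-]; exact: umax.
Qed.

Lemma reflection_ge t : 0 <= t -> z t - l <= reflection t.
Proof.
move=> t0; have [u [_ _ /(_ t t0 (lexx _))]] := reflectionP t0; apply: le_trans.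
by rewrite /pos_part le_max lexx orbT.
Qed.

Lemma reflection_ge0 t : 0 <= t -> 0 <= reflection t.
Proof.
move=> t0; have [u [_ _ /(_ t t0 (lexx _))]] := reflectionP t0; apply: le_trans.
by rewrite /pos_part le_max lexx.
Qed.

Lemma reflection_homo s t : 0 <= s -> s <= t -> reflection s <= reflection t.
Proof.
move=> s0 st; have [u [/andP[u0 us] -> _]] := reflectionP s0.
have [v [_ _ ->]] := reflectionP (le_trans s0 st) => //.
exact: le_trans us st.
Qed.

(** Complementarity: a new running maximum is attained after [s], and at that time the reflected
    path sits on the barrier. *)
Lemma reflection_grows s t : 0 <= s -> s <= t -> reflection s < reflection t ->
  exists u, [/\ s < u, u <= t & z u - reflection u = l].
Proof.
move=> s0 st slt; have [u [/andP[u0 ut] Et Ht]] := reflectionP (le_trans s0 st).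
have [v [_ _ Hs]] := reflectionP s0.
have su : s < u.
  by rewrite ltNge; apply/negP => us; have := Hs u u0 us; rewrite -Et leNgt slt.
exists u; split => //.
have zu : pos_part (z u - l) = z u - l.
  have := le_lt_trans (reflection_ge0 s0) slt; rewrite Et /pos_part.
  by rewrite /Num.max; case: ifP => //; rewrite ltxx.
have : reflection u = z u - l.
  apply/eqP; rewrite eq_le reflection_ge// andbT -zu -Et.
  exact: reflection_homo.
by move=> ->; ring.
Qed.

Lemma reflection0 : reflection 0 = pos_part (z 0 - l).
Proof. by have [u [/le_anti <- -> _]] := reflectionP (lexx 0). Qed.

Lemma reflection_continuous : {within `[0, +oo[, continuous reflection}.
Proof.
apply/within_continuousP => t; rewrite /= in_itv/= andbT => t0 e e0.
have e20 : 0 < e / 3 by rewrite divr_gt0.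
have [|d d0 Hd] := (within_continuousP _ _).1 cz t _ _ e20.
  by rewrite /= in_itv/= t0.
(* The reflection grows over [a, b] by at most the oscillation of [z], here below twice [e / 3]. *)
suff key a b : 0 <= a -> a <= b -> `|a - t| < d -> `|b - t| < d ->
    reflection b - reflection a < e.
  exists d => // s; rewrite /= in_itv/= andbT => s0 st.
  have tt : `|t - t| < d by rewrite subrr normr0.
  have [ts|/ltW ts] := leP t s.
    by rewrite ger0_norm ?subr_ge0 ?reflection_homo//; exact: key.
  by rewrite distrC ger0_norm ?subr_ge0 ?reflection_homo//; exact: key.
move=> a0 ab ad bd; have b0 := le_trans a0 ab.
have [u [/andP[u0 ub] Eb _]] := reflectionP b0.
have [v [_ _ Ha]] := reflectionP a0.
have [ua|/ltW au] := leP u a; first by have := Ha u u0 ua; rewrite Eb; lra.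
have ut : `|u - t| < d.
  by move: ad bd; rewrite !ltr_norml; lra.
have h1 := Ha a a0 (lexx _); rewrite Eb.
have [_ [_]] := pos_part_bounds (z a - l) (z u - l).
rewrite (_ : z u - l - _ = z u - z a); last by ring.
have := ler_norm (pos_part (z u - l) - pos_part (z a - l)).
have : `|z u - z t| < e / 3 by apply: Hd => //; rewrite /= in_itv/= u0.
have : `|z a - z t| < e / 3 by apply: Hd => //; rewrite /= in_itv/= a0.
have := ler_normD (z u - z t) (z t - z a).
rewrite (_ : z u - z t + _ = z u - z a); last by ring.
by rewrite (distrC (z t)); lra.
Qed.

Lemma reflection_is_control : is_control reflection.
Proof.
have /within_continuousP cr := reflection_continuous.
split.
- exact: reflection_ge0.
- exact: reflection_homo.
- move=> t t0; apply/cvgrPdist_lt => e e0.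
  have [|d d0 Hd] := cr t _ e e0; first by rewrite /= in_itv/= t0.
  rewrite near_withinE; apply/nbhs_ballP; exists d => //= s st ts.
  rewrite distrC; apply: Hd; last by rewrite distrC.
  by rewrite /= in_itv/= (le_trans t0 (ltW ts)).
- move=> t t0; apply/cvg_ex; exists (reflection t); apply/cvgrPdist_lt => e e0.
  have [|d d0 Hd] := cr t _ e e0; first by rewrite /= in_itv/= ltW.
  rewrite near_withinE; apply/nbhs_ballP; exists (Num.min d t).
    by rewrite /= lt_min d0.
  move=> s; rewrite /ball/= lt_min => /andP[sd st] ts.
  rewrite distrC; apply: Hd; last by rewrite distrC.
  by rewrite /= in_itv/= andbT; move: st; rewrite ltr_norml; lra.
Qed.

End reflection.

(** * Upper bound: the reflecting strategy *)

Section upper_bound.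
Context {R : realType}.
Variables (D r c y : R) (h : R -> R).
Hypothesis gd : bellman_data D r c y h.
Local Notation H := (hamiltonian c y).
Local Notation slope := (slope D r c y h).
Local Notation hext := (hext D h).
Notation mu := (@lebesgue_measure R).

Variable V : R -> R.
Hypothesis V0 : V 0 = 0.
Hypothesis V_slope : forall s t, 0 <= s -> s <= t -> t <= D ->
  slope s * (t - s) <= V t - V s <= slope t * (t - s).

Variable xs : R.
Hypothesis xs_itv : 0 <= xs <= D.
Hypothesis xs_low : forall x, x <= xs -> hext x <= H r.
Hypothesis xs_high : forall x, xs < x -> x <= D -> H r < hext x.

(** This pays for the initial jump of the reflecting control from a state above [xs]. *)
Lemma value_high x : xs <= x -> x <= D -> r * (x - xs) <= V x - V xs.
Proof.
have [xs0 xsD] := andP xs_itv.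
move=> xsx xD.
suff : r * x - V x <= r * xs - V xs by lra.
apply: (right_limit_le (D := D) (G := fun s => r * s - V s)) => //.
  have cV := value_continuous gd V_slope.
  move=> s; apply: cvgB; last exact: cV.
  by apply: continuous_subspaceT => u; apply: cvgM; [exact: cvg_cst|exact: cvg_id].
move=> s xss sx.
have := V_slope (le_trans xs0 (ltW xss)) sx xD.
by rewrite (slope_high (x := s)) ?xs_high ?(le_trans sx)//; lra.
Qed.

(** The slope of the chord lies between the slope at the lower end and the vertex, where [H] is
    increasing. For [a = b] the slope at [a] is taken. *)
Lemma chord_slope a b : 0 <= a -> a <= xs -> 0 <= b -> b <= xs ->
  exists p, V b - V a = p * (b - a) /\ hext (Num.min a b) <= H p.
Proof.
have [xs0 xsD] := andP xs_itv.
move=> a0 al b0 bl; have [<-|ab] := eqVneq a b.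
  exists (slope a); rewrite !subrr mulr0 minxx; split => //.
  by rewrite (hamiltonian_slope_low gd)// xs_low.
exists ((V b - V a) / (b - a)); rewrite divfK ?subr_eq0 1?eq_sym//; split => //.
wlog ltab : a b a0 al b0 bl ab / a < b.
  move=> W; move: ab; rewrite neq_lt => /orP[ab|ba].
    by apply: W => //; rewrite lt_eqF.
  rewrite minC (_ : _ / _ = (V a - V b) / (a - b)).
    by apply: W => //; rewrite lt_eqF.
  by rewrite -(opprB (V a)) -(opprB a) invrN mulrN mulNr opprK.
rewrite min_l; last exact: ltW.
rewrite -(hamiltonian_slope_low gd (xs_low al)).
have /andP[h1 h2] := V_slope a0 (ltW ltab) (le_trans bl xsD).
apply: (hamiltonian_homo gd); first by rewrite ler_pdivlMr ?subr_gt0.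
apply: (@le_trans _ _ (slope b)); first by rewrite ler_pdivrMr ?subr_gt0.
exact: slope_low_vertex (xs_low bl).
Qed.

(** * The payoff balance along a reflected path *)

Section reflected_path.
Variables (z k : R -> R) (T : R).
Hypothesis T0 : 0 < T.
Hypothesis cz : {within `[0, +oo[, continuous z}.
Let rho := reflection xs z.
Let phi t := z t - rho t.
Hypothesis phi_ge0 : forall t, 0 <= t <= T -> 0 <= phi t.
Hypothesis ik : mu.-integrable `[0, T] (EFin \o k).
Hypothesis kE : forall p s t, 0 <= s -> s <= t -> t <= T ->
  p * (z t - z s) + H p * (t - s) <= \int[mu]_(u in `]s, t]) k u.

Definition running_cost t := hext (phi (clamp 0 T t)).
Local Notation q := running_cost.

Lemma phi_le t : 0 <= t -> phi t <= xs.
Proof. by move=> t0; have := reflection_ge xs cz t0; rewrite /phi /rho; lra. Qed.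

Lemma phi_continuous : {within `[0, +oo[, continuous phi}.
Proof.
by move=> t; apply: cvgB; [exact: cz|exact: reflection_continuous].
Qed.

Lemma running_cost_continuous : continuous q.
Proof.
have cp : {within `[0, T], continuous phi}.
  apply: continuous_subspaceW phi_continuous => t /=; rewrite !in_itv/=.
  by move=> /andP[->].
have := clamp_continuous (ltW T0) cp => cpc t.
apply: (cvg_comp (phi \o clamp 0 T) hext); first exact: cpc.
exact: (@hext_continuous _ _ _ _ _ _ gd).
Qed.

Lemma running_cost_measurable : measurable_fun setT q.
Proof. by apply: continuous_measurable_fun; exact: running_cost_continuous. Qed.

Lemma running_cost_integrable s t (a b : bool) :
  mu.-integrable [set` Interval (BSide a s) (BSide b t)] (EFin \o q).
Proof.
apply: (@bounded_itv_integrable _ _ _ _ _ _ (hext D)).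
  by apply: measurable_funTS; exact: running_cost_measurable.
move=> u _; rewrite ger0_norm; last exact: hext_ge0 gd _.
have /andP[_ xsD] := xs_itv.
apply: (hext_homo gd); apply: le_trans xsD; apply: phi_le.
by have /andP[] := clamp_itv u (ltW T0).
Qed.

(** The payoff accumulated until [t] plus the value of the present state; that it does not grow from
    0 to [T] is the upper bound. *)
Definition balance t := V (phi t) + r * rho t +
  \int[mu]_(u in `]0, t]) q u - \int[mu]_(u in `]0, t]) k u.

Lemma balanceB s t : 0 <= s -> s <= t -> t <= T ->
  balance t - balance s = V (phi t) - V (phi s) + r * (rho t - rho s) +
   \int[mu]_(u in `]s, t]) q u - \int[mu]_(u in `]s, t]) k u.
Proof.
move=> s0 st tT; rewrite /balance.
rewrite -(@Rintegral_itvB _ q (BRight 0) (BRight t) s) ?bnd_simp//; last first.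
  exact: running_cost_integrable.
rewrite -(@Rintegral_itvB _ k (BRight 0) (BRight t) s) ?bnd_simp//.
  by ring.
apply: integrableS ik => //.
by move=> u /=; rewrite !in_itv/= => /andP[/ltW -> ut] /=; exact: le_trans ut tT.
Qed.

Lemma running_cost_le s t M : 0 <= s -> s <= t -> t <= T ->
  (forall u, s <= u -> u <= t -> hext (phi u) <= M) ->
  \int[mu]_(u in `]s, t]) q u <= M * (t - s).
Proof.
move=> s0 st tT HM; rewrite -(Rintegral_itv_cst false false _ st).
apply: le_Rintegral => //.
- exact: running_cost_integrable.
- exact: cst_itv_integrable.
move=> u /=; rewrite in_itv/= => /andP[/ltW su ut]; rewrite /q clamp_id ?HM//.
by rewrite (le_trans s0 su) (le_trans ut tT).
Qed.

(** While [rho] rests, the state moves like [z]. On a short interval the chord momentum [p] turns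
    the increment of [V] into energy minus [H p] per unit of time, and [H p] covers the running cost
    up to [e]. *)
Lemma balance_no_push s t : 0 <= s -> s <= t -> t <= T ->
  (forall u, s <= u -> u <= t -> rho u = rho s) -> balance t <= balance s.
Proof.
move=> s0 st tT rc; apply: le_of_small_increments => // x e /andP[sx xt] e0.
have x0 := le_trans s0 sx; have xT := le_trans xt tT.
have /cvgrPdist_lt/(_ _ (divr_gt0 e0 (@ltr0n R 2)))/nbhs_ballP[d /= d0 Hd] :=
  @running_cost_continuous x.
have Hq u : 0 <= u -> u <= T -> x - d < u -> u < x + d ->
    `|hext (phi x) - hext (phi u)| < e / 2.
  move=> u0 uT xu ux; have := Hd u; rewrite /ball/= /q !clamp_id ?u0 ?x0//.
  by apply; rewrite ltr_norml; apply/andP; split; lra.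
exists d => // a b sa xa ab bx bt _; rewrite -subr_le0.
have a0 := le_trans s0 sa; have bT := le_trans bt tT.
have b0 := le_trans a0 ab; have aT := le_trans ab bT.
rewrite balanceB// (rc a) ?(le_trans ab)// (rc b) ?(le_trans sa)// subrr mulr0 addr0.
have [||||p [VE Hp]] := @chord_slope (phi a) (phi b).
- by rewrite phi_ge0 ?a0.
- exact: phi_le.
- by rewrite phi_ge0 ?b0.
- exact: phi_le.
have := kE p a0 ab bT.
have zE : z b - z a = phi b - phi a.
  by rewrite /phi (rc a) ?(le_trans ab)// (rc b) ?(le_trans sa)//; ring.
rewrite zE -VE.
have hm u : x - d < u -> u < x + d -> 0 <= u -> u <= T ->
    hext (phi u) <= hext (Num.min (phi a) (phi b)) + e.
  move=> xu ux u0 uT; have := Hq u u0 uT xu ux.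
  have := Hq a a0 aT xa (le_lt_trans ab bx).
  have := Hq b b0 bT (lt_le_trans xa ab) bx.
  by rewrite /Num.min; case: ifP => _; rewrite !ltr_norml; lra.
have := @running_cost_le a b (hext (Num.min (phi a) (phi b)) + e) a0 ab bT.
have ba : 0 <= b - a by rewrite subr_ge0.
have := ler_wpM2r ba Hp.
move=> h1 h2 h3; rewrite mulrDl in h2.
have : \int[mu]_(u in `]a, b]) q u <=
    hext (Num.min (phi a) (phi b)) * (b - a) + e * (b - a).
  apply: h2 => u au ub; apply: hm.
  - exact: lt_le_trans xa au.
  - exact: le_lt_trans ub bx.
  - exact: le_trans a0 au.
  - exact: le_trans ub bT.
lra.
Qed.

(** Between two visits to [xs] the increments of [z] and [rho] agree. Momentum [r] pays for the
    control and leaves [H r] per unit of time, which covers the running cost below [xs]. *)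
Lemma balance_loop s t : 0 <= s -> s <= t -> t <= T ->
  phi s = xs -> phi t = xs -> balance t <= balance s.
Proof.
move=> s0 st tT ps pt; rewrite -subr_le0 balanceB// ps pt subrr add0r.
have := kE r s0 st tT.
have -> : z t - z s = rho t - rho s.
  by move: ps pt; rewrite /phi; lra.
have := @running_cost_le s t (H r) s0 st tT.
move=> h1 h2; have : \int[mu]_(u in `]s, t]) q u <= H r * (t - s).
  by apply: h1 => u su ut; apply: xs_low; apply: phi_le; exact: le_trans s0 su.
lra.
Qed.

Lemma balance_le : balance T <= balance 0.
Proof.
have TW := ltW T0.
pose Z := [set u | 0 <= u <= T /\ phi u = xs].
have rho_const s t : 0 <= s -> s <= t -> t <= T ->
    (forall u, s < u -> u <= t -> ~ Z u) -> rho t = rho s.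
  move=> s0 st tT nZ; apply/eqP; rewrite eq_le; apply/andP; split; last exact: reflection_homo.
  rewrite leNgt.
  apply/negP => /(reflection_grows cz s0 st)[u [su ut zu]].
  apply: (nZ u su ut); split => //.
  by rewrite (le_trans s0 (ltW su)) (le_trans ut tT).
have [Z0|/set0P Zn] := eqVneq Z set0.
  apply: balance_no_push => // u u0 uT; apply: rho_const => // v _ _.
  by rewrite Z0.
have lZ : has_lbound Z by exists 0 => u [/andP[]].
have uZ : has_ubound Z by exists T => u [/andP[]].
have [u0 Zu0] := Zn.
have [i0 iT] : 0 <= inf Z /\ inf Z <= T.
  split; first by apply: lb_le_inf => // u [/andP[]].
  by apply: le_trans (ge_inf lZ Zu0) _; case: Zu0 => /andP[].
have [s0 sT] : 0 <= sup Z /\ sup Z <= T.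
  split; last by apply: ge_sup => // u [/andP[]].
  by apply: le_trans (ub_le_sup uZ Zu0); case: Zu0 => /andP[].
(* The set of visits is closed, so a first and a last visit exist. *)
have clZ v : 0 <= v -> v <= T -> ~ Z v -> exists2 d, 0 < d &
    forall u, v - d < u -> u < v + d -> ~ Z u.
  move=> v0 vT nZ; have pv : 0 < `|phi v - xs|.
    rewrite normr_gt0 subr_eq0; apply/eqP => E; apply: nZ; split => //.
    by rewrite v0.
  have [|d d0 Hd] := (within_continuousP _ _).1 phi_continuous v _ _ pv.
    by rewrite /= in_itv/= v0.
  exists d => // u vu uv [/andP[u00 _] E]; have := Hd u.
  rewrite /= in_itv/= u00 E (distrC xs) ltxx => /(_ isT) h1.
  suff /h1 : `|u - v| < d by [].
  by rewrite ltr_norml; apply/andP; split; lra.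
have Zi : Z (inf Z).
  apply: contrapT => /(clZ _ i0 iT)[d d0 Hd].
  have [u Zu iu] : exists2 u, Z u & u < inf Z + d by apply: inf_lt => //; rewrite ltrDl.
  apply: (Hd u) => //; apply: lt_le_trans (ge_inf lZ Zu); lra.
have Zs : Z (sup Z).
  apply: contrapT => /(clZ _ s0 sT)[d d0 Hd].
  have [u Zu iu] : exists2 u, Z u & sup Z - d < u by apply: sup_gt => //; lra.
  apply: (Hd u) => //; apply: le_lt_trans (ub_le_sup uZ Zu) _; lra.
have is_ : inf Z <= sup Z by apply: ub_le_sup.
have rlow u : 0 <= u -> u < inf Z -> rho u = rho 0.
  move=> u00 ui; apply: (rho_const 0 u (lexx 0) u00 (le_trans (ltW ui) iT)).
  move=> v _ vu Zv; have := ge_inf lZ Zv; rewrite leNgt (le_lt_trans vu ui)//.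
(* The first visit itself belongs to [Z], so [rho_const] stops short of it and continuity gives the
   value there. *)
have ri : rho (inf Z) = rho 0.
  move: i0; rewrite le_eqVlt => /predU1P[<- //|i0'].
  apply/eqP; rewrite eq_le; apply/andP; split; last first.
    by apply: (reflection_homo xs cz); [exact: lexx|exact: ltW].
  apply/ler_addgt0Pr => e e0.
  have [|d d0 Hd] := (within_continuousP _ _).1 (@reflection_continuous _ xs z cz) (inf Z) _ _ e0.
    by rewrite /= in_itv/= ltW.
  pose w := Num.min (inf Z) d.
  have w0 : 0 < w by rewrite lt_min i0'.
  have [w1 w2] : w <= inf Z /\ w <= d by rewrite !ge_min !lexx orbT.
  have := Hd (inf Z - w / 2); rewrite /= in_itv/= andbT -/rho rlow; [|lra|lra].
  rewrite addrAC subrr add0r normrN ger0_norm; last lra.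
  move=> /(_ _ _); rewrite ltr_norml => h1.
  have : - e < rho 0 - rho (inf Z) < e by apply: h1; lra.
  lra.
apply: (@le_trans _ _ (balance (sup Z))).
  apply: balance_no_push => // u su uT; apply: rho_const => // v sv vu Zv.
  by have := ub_le_sup uZ Zv; rewrite leNgt sv.
apply: (@le_trans _ _ (balance (inf Z))).
  by apply: balance_loop => //; [case: Zi|case: Zs].
apply: balance_no_push => // u u00; rewrite le_eqVlt => /predU1P[->//|ui].
exact: rlow.
Qed.

End reflected_path.
End upper_bound.

(** * Admissibility and cost of the reflecting strategy *)

Section reflecting_strategy.
Context {R : realType}.
Variables (D r c1 c2 y : R) (h : R -> R).
Hypotheses (hc1 : 0 < c1) (hc2 : 0 < c2).
Let c := (c1^-1 + c2^-1)^-1.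
Hypothesis gd : bellman_data D r c y h.
Let hc : 0 < c. Proof. by case: gd => -[]. Qed.
Local Notation H := (hamiltonian c y).
Local Notation slope := (slope D r c y h).
Local Notation hext := (hext D h).
Notation mu := (@lebesgue_measure R).

Variable V : R -> R.
Hypothesis V0 : V 0 = 0.
Hypothesis V_slope : forall s t, 0 <= s -> s <= t -> t <= D ->
  slope s * (t - s) <= V t - V s <= slope t * (t - s).

Variable xs : R.
Hypothesis xs_itv : 0 <= xs <= D.
Hypothesis xs_low : forall x, x <= xs -> hext x <= H r.
Hypothesis xs_high : forall x, xs < x -> x <= D -> H r < hext x.

Variable x : R.
Hypothesis x_itv : 0 <= x <= D.

Definition free_path (psi : (R -> R) * (R -> R)) t :=
  x + y * t + psi.1 t - psi.2 t.

Definition reflect psi := reflection xs (free_path psi).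

Lemma free_path_continuous psi : path2 psi ->
  {within `[0, +oo[, continuous (free_path psi)}.
Proof.
move=> [[cp1 _] [cp2 _]] t; apply: cvgB; last exact: cp2.
apply: cvgD; last exact: cp1.
apply: cvgD; first exact: cvg_cst.
by apply: continuous_subspaceT => u; apply: cvgM; [exact: cvg_cst|exact: cvg_id].
Qed.

Lemma reflect_strategy : strategy reflect.
Proof.
split=> [psi ppsi|t psi psi' t0 ppsi ppsi' E s s0 st].
  exact: reflection_is_control (free_path_continuous ppsi).
rewrite /reflect /reflection; congr sup.
apply/seteqP; split => _ [u /= + <-]; rewrite in_itv/= => /andP[u0 us];
  exists u; rewrite /= ?in_itv/= ?u0//;
  by have [E1 E2] := E u u0 (le_trans us st); rewrite /free_path E1 E2.
Qed.

Lemma reflect_start psi : path2 psi ->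
  free_path psi 0 = x /\ reflect psi 0 = pos_part (x - xs).
Proof.
move=> ppsi; have [[_ p1] [_ p2]] := ppsi.
have E : free_path psi 0 = x by rewrite /free_path p1 p2; ring.
by split => //; rewrite /reflect (reflection0 _ (free_path_continuous ppsi)) E.
Qed.

(** The reflected state is continuous and starts nonnegative, so a negative value would come after a
    zero, hence after the hitting time. *)
Lemma reflect_admissible : admissible D y x reflect.
Proof.
split; first exact: reflect_strategy.
move=> psi ppsi t t0 tT; have cz := free_path_continuous ppsi.
have [z0 r0] := reflect_start ppsi.
have dE s : dynamics y x psi (reflect psi) s = free_path psi s - reflect psi s by [].
have [xs0 xsD] := andP xs_itv.
rewrite dE; apply/andP; split; last first.
  by have := reflection_ge xs cz t0; rewrite /reflect; lra.
rewrite leNgt; apply/negP => neg.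
pose phi s := free_path psi s - reflect psi s.
have cphi : {within `[0, t], continuous phi}.
  have cr := @reflection_continuous _ xs _ cz.
  have cphi : {within `[0, +oo[, continuous phi}.
    by move=> u; apply: cvgB; [exact: cz|exact: cr].
  by apply: continuous_subspaceW cphi => u /=; rewrite !in_itv/= => /andP[->].
have p0 : 0 <= phi 0.
  rewrite /phi z0 r0 /pos_part /Num.max; case/andP: x_itv => x0 xD; case: ifP; lra.
have [|s] := IVT (v := 0) t0 cphi.
  by rewrite ge_min le_max (ltW neg) p0 orbT.
rewrite in_itv/= => /andP[s0 st] phis.
have := le_trans tT (hitting_time_le (y := y) (x := x) s0 phis).
rewrite lee_fin => ts; move: neg; rewrite -/(phi t).
by rewrite (_ : t = s) ?phis ?ltxx//; apply/eqP; rewrite eq_le ts st.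
Qed.

Lemma reflect_cost psi : finite_hitting y x reflect psi ->
  (cost r c1 c2 y h x psi (reflect psi) <= (V x)%:E)%E.
Proof.
move=> [ppsi fin]; have cz := free_path_continuous ppsi.
have cr := reflect_strategy.1 _ ppsi.
have [T [T0 TE phiT phiN]] := hitting_timeP ppsi cr fin.
rewrite /cost TE /=.
have [xs0 xsD] := andP xs_itv; have [x0 xD] := andP x_itv.
have [z0 r0] := reflect_start ppsi.
pose phi t := free_path psi t - reflect psi t.
have dE s : dynamics y x psi (reflect psi) s = phi s by [].
have phi_itv t : 0 <= t <= T -> 0 <= phi t <= D.
  move=> /andP[t0 tT]; have [_ /(_ psi ppsi t t0)] := reflect_admissible.
  by rewrite dE; apply; rewrite TE lee_fin.
have phi0 : phi 0 = x - pos_part (x - xs) by rewrite /phi z0 r0.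
(* An initial jump from [x] down to [xs] costs [r * (x - xs)], which [value_high] covers. *)
have Vx : V (phi 0) + r * reflect psi 0 <= V x.
  rewrite phi0 r0 /pos_part /Num.max; case: ltP => [xxs|_]; last by rewrite mulr0 addr0 subr0.
  rewrite (_ : x - (x - xs) = xs); last by ring.
  by have := value_high gd V_slope xs_itv xs_high (x := x); rewrite -subr_ge0 (ltW xxs) => /(_ isT xD); lra.
have E0 := energy_ge0 T psi (ltW hc1) (ltW hc2).
(* A hitting time 0 is treated apart, as the balance requires a positive horizon. *)
move: T0; rewrite le_eqVlt => /predU1P[T0|T0].
  move: phiT E0; rewrite -{}T0 {TE phiN} => phiT E0.
  rewrite set_itv1 integral_set1 add0e.
  apply: (@le_trans _ _ (r * reflect psi 0)%:E); first by rewrite -[leRHS]sube0; apply: leeB.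
  rewrite lee_fin; move: Vx phiT; rewrite dE => + E.
  by rewrite E V0 add0r.
have [[ac1 ac2]|nac] := pselect (abs_continuous 0 T psi.1 /\ abs_continuous 0 T psi.2); last first.
  by rewrite /energy asboolF//= addeNy leNye.
have [k [mk k0 kle kE]] := abs_continuous_energy hc1 hc2 T0 ppsi ac1 ac2.
(* Infinite energy makes the cost [-oo]; otherwise [k] is integrable. *)
have [kinf|kfin] := eqVneq (\int[mu]_(t in `[0%R, T]) (k t)%:E)%E +oo%E.
  have -> : energy c1 c2 T psi = +oo%E.
    by apply/eqP; rewrite -leye_eq -kinf.
  by rewrite addeNy leNye.
have ik : mu.-integrable `[0, T] (EFin \o k).
  apply/integrableP; split; first by apply/measurable_EFinP; exact: measurable_funTS.
  under eq_integral do rewrite /= ger0_norm//.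
  by rewrite ltey.
(* The term [- y * p] of the Hamiltonian cancels the drift contained in the free path. *)
have kH p s t : 0 <= s -> s <= t -> t <= T ->
    p * (free_path psi t - free_path psi s) + H p * (t - s) <=
    \int[mu]_(u in `]s, t]) k u.
  move=> s0 st tT; apply: le_trans (kE p s t s0 st tT _); last first.
    apply: integrableS ik => //.
    move=> u /=; rewrite !in_itv/= => /andP[su ut].
    by rewrite (le_trans s0 (ltW su)) (le_trans ut tT).
  rewrite /free_path /hamiltonian -/c le_eqVlt; apply/orP; left; apply/eqP.
  by field; rewrite gt_eqF.
have phi0' t : 0 <= t <= T -> 0 <= free_path psi t - reflection xs (free_path psi) t.
  by move=> /phi_itv/andP[].
pose q := running_cost D h xs (free_path psi) T.
have : V (phi T) + r * reflect psi T + \int[mu]_(u in `]0, T]) q u -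
    \int[mu]_(u in `]0, T]) k u <= V (phi 0) + r * reflect psi 0 +
    \int[mu]_(u in `]0, 0]) q u - \int[mu]_(u in `]0, 0]) k u.
  exact: (balance_le gd V_slope xs_itv xs_low T0 cz phi0' ik kH).
rewrite (phiT : phi T = 0) V0 add0r.
rewrite [`]0, 0]%classic]set_itv_ge ?bnd_simp ?ltxx// !Rintegral_set0 addr0 subr0 => bal.
have iq : mu.-integrable `[0, T] (EFin \o q).
  exact: (running_cost_integrable gd xs_itv T0 cz 0 T true false).
have hq : (\int[mu]_(t in `[0%R, T]) (h (dynamics y x psi (reflect psi) t))%:E =
    (\int[mu]_(t in `]0%R, T]) q t)%:E)%E.
  rewrite /Rintegral fineK; last first.
    apply: integrable_fin_num => //; apply: integrableS iq => //.
    by move=> u /=; rewrite !in_itv/= => /andP[/ltW -> ->].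
  rewrite integral_itv_obnd_cbnd; last first.
    by apply/measurable_EFinP; apply: measurable_funTS; exact: (running_cost_measurable gd xs T0 cz).
  apply: eq_integral => t; rewrite inE/= in_itv/= => tT.
  by rewrite dE /q /running_cost clamp_id// (hextE h (phi_itv t tT)).
have kR : (\int[mu]_(t in `[0%R, T]) (k t)%:E = (\int[mu]_(t in `]0%R, T]) k t)%:E)%E.
  rewrite /Rintegral fineK; last first.
    apply: integrable_fin_num => //; apply: integrableS ik => //.
    by move=> u /=; rewrite !in_itv/= => /andP[/ltW -> ->].
  by rewrite integral_itv_obnd_cbnd//; apply/measurable_EFinP; exact: measurable_funTS.
rewrite hq; apply: le_trans (_ : (_ - (\int[mu]_(t in `]0%R, T]) k t)%:E <= _)%E).
  by apply: leeB => //; rewrite -kR.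
rewrite -!EFinD lee_fin.
by apply: le_trans (le_trans bal Vx); rewrite (addrC (\int[mu]_(t in _) q t)).
Qed.

End reflecting_strategy.

(** * Lower bound: steering with constant momenta *)

Section steering.
Context {R : realType}.
Variables (D r c1 c2 y : R) (h : R -> R).
Hypotheses (hc1 : 0 < c1) (hc2 : 0 < c2).
Let c := (c1^-1 + c2^-1)^-1.
Hypothesis gd : bellman_data D r c y h.
Let hc : 0 < c. Proof. by case: gd => -[]. Qed.
Local Notation H := (hamiltonian c y).
Local Notation slope := (slope D r c y h).
Local Notation hext := (hext D h).
Notation mu := (@lebesgue_measure R).

Variables (x : R) (alpha : (R -> R) * (R -> R) -> (R -> R)).
Hypothesis adm : admissible D y x alpha.

(* The optimal splitting of the momentum [p] between the two controls is
   [(p / (2 c1), - p / (2 c2))]; [theta] is a primitive of the momentum. *)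
Definition split_path (theta : R -> R) : (R -> R) * (R -> R) :=
  (fun t => theta t / (2 * c1), fun t => - theta t / (2 * c2)).

Definition energy_rate (theta : R -> R) (t : R) :=
  c1 * derive1 (split_path theta).1 t ^+ 2 + c2 * derive1 (split_path theta).2 t ^+ 2.

Local Notation rho theta := (alpha (split_path theta)).
Local Notation phi theta := (dynamics y x (split_path theta) (rho theta)).

(** A Lipschitz bound gives absolute continuity on every [0, T] and survives the appending of a
    linear piece. *)
Definition lipschitz_path (theta : R -> R) :=
  theta 0 = 0 /\ exists K, forall s t, `|theta t - theta s| <= K * `|t - s|.

(** The invariant of the maximizer: the state is [a] at time [T], 0 was not met before, and a payoff
    [J] is secured. [G] and [E] are bounds for the running cost and the energy. The energy is taken
    over the open interval because extending [theta] past [T] may change its derivative at [T]. *)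
Definition reached_by (theta : R -> R) (T a J : R) := exists G E,
  [/\ 0 <= T, lipschitz_path theta &
      (forall t, 0 <= t -> t < T -> phi theta t != 0) /\ phi theta T = a] /\
  [/\ measurable_fun `]0, T[ (energy_rate theta),
      (\int[mu]_(t in `]0%R, T[) (energy_rate theta t)%:E <= E%:E)%E,
      (G%:E <= \int[mu]_(t in `[0%R, T]) (hext (phi theta t))%:E)%E &
      J <= G + r * rho theta T - E].

Definition reached a J := exists theta T, reached_by theta T a J.

Lemma lipschitz_continuous theta : lipschitz_path theta -> continuous theta.
Proof.
move=> [_ [K HK]] t; apply/cvgrPdist_lt => e e0.
have K0 : 0 < `|K| + 1 by rewrite ltr_wpDl.
apply/nbhs_ballP; exists (e / (`|K| + 1)); first by rewrite /= divr_gt0.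
move=> s; rewrite /ball/= ltr_pdivlMr// => ts; apply: le_lt_trans ts.
apply: le_trans (HK s t) _; rewrite mulrC ler_wpM2l//.
by apply: le_trans (ler_norm K) _; rewrite lerDl.
Qed.

Lemma lipschitz_path2 theta : lipschitz_path theta -> path2 (split_path theta).
Proof.
move=> lt; have ct := lipschitz_continuous lt; have [t0 _] := lt.
split; split => /=; rewrite ?t0 ?oppr0 ?mul0r//; apply: continuous_subspaceT => u.
  by apply: cvgM; [exact: ct|exact: cvg_cst].
by apply: cvgM; [apply: cvgN; exact: ct|exact: cvg_cst].
Qed.

Lemma lipschitz_abs_continuous (f : R -> R) K a b :
  (forall s t, `|f t - f s| <= K * `|t - s|) -> abs_continuous a b f.
Proof.
move=> HK e e0; have K0 : 0 < `|K| + 1 by rewrite ltr_wpDl.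
exists (e / (`|K| + 1)); first by rewrite divr_gt0.
move=> n u v uv _; rewrite ltr_pdivlMr// => ud; apply: le_lt_trans ud.
rewrite mulr_suml; apply: ler_sum => i _.
have [_ [ui _]] := uv i.
apply: le_trans (HK _ _) _; rewrite ger0_norm ?subr_ge0// mulrC.
by rewrite ler_wpM2l ?subr_ge0//; apply: le_trans (ler_norm K) _; rewrite lerDl.
Qed.

Lemma dynamics_split theta t : phi theta t =
  x + y * t + theta t / (2 * c) - rho theta t.
Proof.
rewrite /dynamics /= /c; congr (_ - _); rewrite -!addrA; congr (_ + (_ + _)).
by field; rewrite !gt_eqF// addr_gt0.
Qed.

Lemma split_control theta : lipschitz_path theta -> is_control (rho theta).
Proof. by move=> lt; case: adm => -[+ _] _; apply; exact: lipschitz_path2. Qed.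

Lemma split_admissible theta t : lipschitz_path theta -> 0 <= t ->
  (forall s, 0 <= s -> s < t -> phi theta s != 0) -> 0 <= phi theta t <= D.
Proof.
move=> lt t0 nz; case: adm => _ /(_ _ (lipschitz_path2 lt) t t0); apply.
exact: le_hitting_time.
Qed.

Definition extend (theta : R -> R) (T p t : R) :=
  if t <= T then theta t else theta T + p * (t - T).

Lemma extend_lipschitz theta T p : 0 <= T -> lipschitz_path theta ->
  lipschitz_path (extend theta T p).
Proof.
move=> T0 [t0 [K HK]]; split; first by rewrite /extend T0.
exists (`|K| + `|p|) => s t.
wlog st : s t / s <= t.
  by move=> W; have [/W//|/ltW/W] := leP s t; rewrite distrC (distrC s).
have K0 := normr_ge0 K; have p0 := normr_ge0 p.
have HK' u v : u <= v -> `|theta v - theta u| <= `|K| * (v - u).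
  move=> uv; apply: le_trans (HK _ _) _; rewrite ger0_norm ?subr_ge0//.
  by rewrite ler_wpM2r ?subr_ge0// ler_norm.
rewrite (ger0_norm (_ : 0 <= t - s)) ?subr_ge0// /extend.
case: (leP t T) => tT; case: (leP s T) => sT.
- have := HK' _ _ st; have : 0 <= `|p| * (t - s) by rewrite mulr_ge0// subr_ge0.
  lra.
- by exfalso; lra.
- rewrite (_ : _ - _ = (theta T - theta s) + p * (t - T)); last by ring.
  apply: le_trans (ler_normD _ _) _; have := HK' _ _ sT.
  have tT0 : 0 <= t - T by rewrite subr_ge0 ltW.
  rewrite normrM (ger0_norm tT0) => h1.
  have : 0 <= `|p| * (T - s) by rewrite mulr_ge0// subr_ge0.
  have : 0 <= `|K| * (t - T) by rewrite mulr_ge0.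
  lra.
- rewrite (_ : _ - _ = p * (t - s)); last by ring.
  rewrite normrM (ger0_norm (_ : 0 <= t - s)) ?subr_ge0//.
  have : 0 <= `|K| * (t - s) by rewrite mulr_ge0// subr_ge0.
  lra.
Qed.

(** By causality the continuation after [T] leaves the past actions of the minimizer unchanged. *)
Lemma extend_rho theta T p t : 0 <= T -> lipschitz_path theta -> 0 <= t -> t <= T ->
  rho (extend theta T p) t = rho theta t.
Proof.
move=> T0 lt t0 tT; case: adm => -[_ causal] _.
apply: (causal T) => //; do ?[exact: lipschitz_path2|
  by apply: lipschitz_path2; exact: extend_lipschitz].
by move=> s s0 sT; rewrite /split_path /extend/= sT.
Qed.

Lemma extend_phi theta T p t : 0 <= T -> lipschitz_path theta -> 0 <= t -> t <= T ->
  phi (extend theta T p) t = phi theta t.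
Proof.
by move=> T0 lt t0 tT; rewrite !dynamics_split extend_rho// /extend tT.
Qed.

Lemma extend_rate_low theta T p t : t < T ->
  energy_rate (extend theta T p) t = energy_rate theta t.
Proof.
move=> tT; rewrite /energy_rate !derive1E; do ![congr (_ + _)|congr (_ * _)|congr (_ ^+ _)];
  apply: near_eq_derive; near=> s; rewrite /= /extend ifT//; apply: ltW; near: s; exact: lt_nbhsl.
Unshelve. all: by end_near. Qed.

Lemma extend_rate_high theta T p t : T < t ->
  energy_rate (extend theta T p) t = p ^+ 2 / (4 * c).
Proof.
move=> Tt; rewrite /energy_rate /=.
have E k : derive1 (fun s => extend theta T p s * k) t = p * k.
  rewrite derive1E.
  transitivity ('D_1 (fun s => (theta T + p * (s - T)) * k) t).
    by apply: near_eq_derive; near=> s; rewrite /extend ifF//; apply/negbTE;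
      rewrite -ltNge; near: s; exact: lt_nbhsr.
  rewrite -derive1E (_ : (fun s => _) = (fun s : R => (theta T - p * T) * k + (p * k) * s)).
    rewrite derive1E deriveD; [|exact: derivable_cst|exact: derivableZ].
    by rewrite derive_cst add0r deriveZ//= derive_id /GRing.scale/= mulr1.
  by apply/funext => s; ring.
rewrite (_ : (fun s => - extend theta T p s / (2 * c2)) =
  (fun s => extend theta T p s * (- (2 * c2)^-1))); last first.
  by apply/funext => s; rewrite mulrN mulNr.
by rewrite !E /c; field; rewrite !gt_eqF// addr_gt0.
Unshelve. all: by end_near. Qed.

Lemma ge0_integral_itv_split (a b : itv_bound R) (T : R) (f : R -> R) :
  (a <= BRight T)%O -> (BRight T <= b)%O ->
  measurable_fun [set` Interval a b] f -> (forall t, 0 <= f t) ->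
  (\int[mu]_(t in [set` Interval a b]) (f t)%:E =
   \int[mu]_(t in [set` Interval a (BRight T)]) (f t)%:E +
   \int[mu]_(t in [set` Interval (BRight T) b]) (f t)%:E)%E.
Proof.
move=> aT Tb mf f0; rewrite (itv_bndbnd_setU aT Tb) ge0_integral_setU//.
- by rewrite -itv_bndbnd_setU//; exact/measurable_EFinP.
- by move=> t _; rewrite lee_fin.
- apply/disj_setPS => t [/=]; rewrite !in_itv/= => /andP[_ tT] /andP[].
  by rewrite ltNge tT.
Qed.

Lemma extend_energy (theta : R -> R) (T S p E : R) : 0 <= T -> T <= S ->
  measurable_fun `]0, T[ (energy_rate theta) ->
  (\int[mu]_(t in `]0%R, T[) (energy_rate theta t)%:E <= E%:E)%E ->
  measurable_fun `]0, S[ (energy_rate (extend theta T p)) /\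
  (\int[mu]_(t in `]0%R, S[) (energy_rate (extend theta T p) t)%:E <=
    (E + p ^+ 2 / (4 * c) * (S - T))%:E)%E.
Proof.
move=> T0 TS me le_E; set e' := energy_rate (extend theta T p).
have e'0 t : 0 <= e' t.
  by rewrite /e' /energy_rate addr_ge0// mulr_ge0 ?sqr_ge0// ltW.
have elow t : t \in `]0, T[%classic -> energy_rate theta t = e' t.
  by rewrite inE/= in_itv/= => /andP[_ tT]; rewrite /e' extend_rate_low.
have me' : measurable_fun `]0, T[ e' by apply: eq_measurable_fun me.
have ie' : (\int[mu]_(t in `]0%R, T[) (e' t)%:E <= E%:E)%E.
  apply: le_trans le_E; rewrite le_eqVlt; apply/orP; left; apply/eqP.
  by apply: eq_integral => t /elow ->.
move: TS; rewrite le_eqVlt => /predU1P[<-|TS].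
  by rewrite subrr mulr0 addr0.
have b1 : (BRight 0 <= BRight T :> itv_bound R)%O by rewrite bnd_simp.
have b2 : (BRight T <= BLeft S :> itv_bound R)%O by rewrite bnd_simp.
have ehigh t : t \in `]T, S[%classic -> p ^+ 2 / (4 * c) = e' t.
  by rewrite inE/= in_itv/= => /andP[Tt _]; rewrite /e' extend_rate_high.
have meS : measurable_fun `]0, S[ e'.
  rewrite (itv_bndbnd_setU b1 b2); apply/measurable_funU => //; split.
    exact/measurable_fun_itv_bndo_bndcP.
  apply: eq_measurable_fun ehigh _; exact: measurable_cst.
split => //; rewrite (ge0_integral_itv_split b1 b2)// EFinD; apply: leeD.
  by rewrite -integral_itv_bndo_bndc//; exact/measurable_EFinP.
rewrite -(Rintegral_itv_cst false true _ (ltW TS)) /Rintegral fineK.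
  rewrite le_eqVlt; apply/orP; left; apply/eqP.
  by apply: eq_integral => t /ehigh ->.
apply: integrable_fin_num; first exact: measurable_itv.
exact: (cst_itv_integrable T S false true).
Qed.

Lemma phi_measurable (theta : R -> R) (T : R) : lipschitz_path theta ->
  measurable_fun `[0, T] (hext \o phi theta).
Proof.
move=> lt; have ct := lipschitz_continuous lt.
have [_ rho_homo _ _] := split_control lt.
(* [Num.max 0 t] makes the control nondecreasing on the whole line, hence measurable. *)
pose f t := x + y * t + theta t / (2 * c) - rho theta (Num.max 0 t).
apply: (@eq_measurable_fun _ _ _ _ _ (hext \o f)).
  by move=> t; rewrite inE/= in_itv/= => /andP[t0 _]; rewrite /= dynamics_split /f max_r.
apply: measurable_funTS; apply: measurableT_comp.
  by apply: continuous_measurable_fun; exact: (hext_continuous gd).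
apply: measurable_funB.
  apply: continuous_measurable_fun => t; apply: cvgD; last first.
    by apply: cvgM; [exact: ct|exact: cvg_cst].
  by apply: cvgD; [exact: cvg_cst|apply: cvgM; [exact: cvg_cst|exact: cvg_id]].
apply: nondecreasing_measurable => // s t st; apply: rho_homo.
  by rewrite le_max lexx.
by rewrite ge_max le_max lexx/= le_max st orbT.
Qed.

Lemma extend_running_cost (theta : R -> R) (T S p G m : R) : 0 <= T -> T <= S -> 0 <= m ->
  lipschitz_path theta ->
  (G%:E <= \int[mu]_(t in `[0%R, T]) (hext (phi theta t))%:E)%E ->
  (forall t, T <= t -> t < S -> m <= hext (phi (extend theta T p) t)) ->
  ((G + m * (S - T))%:E <=
    \int[mu]_(t in `[0%R, S]) (hext (phi (extend theta T p) t))%:E)%E.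
Proof.
move=> T0 TS m0 lt GE mE; have lt' := extend_lipschitz p T0 lt.
have b1 : (BLeft 0 <= BRight T :> itv_bound R)%O by rewrite bnd_simp.
have b2 : (BRight T <= BRight S :> itv_bound R)%O by rewrite bnd_simp.
have h0 t : 0 <= (hext \o phi (extend theta T p)) t by exact: hext_ge0 gd _.
have mp := @phi_measurable _ S lt'.
rewrite (ge0_integral_itv_split b1 b2 mp h0) EFinD; apply: leeD.
  apply: le_trans GE _; rewrite le_eqVlt; apply/orP; left; apply/eqP.
  apply: eq_integral => t; rewrite inE/= in_itv/= => /andP[t0 tT].
  by rewrite extend_phi.
have mTS : measurable_fun `]T, S] (hext \o phi (extend theta T p)).
  apply: measurable_funS mp => //; move=> t /=; rewrite !in_itv/= => /andP[Tt ->].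
  by rewrite (le_trans T0 (ltW Tt)).
(* At time [S] the state may already have fallen below the level, so this endpoint is removed before
   the comparison. *)
rewrite -integral_itv_bndo_bndc; last first.
  by apply/measurable_EFinP; exact/measurable_fun_itv_bndo_bndcP.
rewrite -(Rintegral_itv_cst false true m TS) /Rintegral fineK; last first.
  apply: integrable_fin_num; first exact: measurable_itv.
  exact: (cst_itv_integrable T S false true).
apply: ge0_le_integral_nonmeasurable => t; rewrite /= in_itv/= ?lee_fin//.
by move=> /andP[Tt tS]; rewrite mE// ltW.
Qed.

(* Hold the momentum [p] until the state drops to [l] or the time [T0] has
   elapsed. *)
Lemma steer (a J p l T0 : R) : reached a J -> 0 <= p -> p <= r -> 0 <= l -> 0 <= T0 ->
  exists a' s, [/\ 0 <= a' <= D, 0 <= s <= T0, a' <= l \/ s = T0,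
    a' <= a + (y + p / (2 * c)) * s &
    reached a' (J + p * (a - a') + (hext l - H p) * s)].
Proof.
move=> [theta [T [G [E [[T_ge0 lt [nz phiT]] [me le_E GE JE]]]]]] p0 pr l0 T00.
have lt' := extend_lipschitz p T_ge0 lt.
set theta' := extend theta T p in lt'.
have cr := split_control lt'; have pp := lipschitz_path2 lt'.
(* The momentum is released at the infimum of these times, which right continuity makes attained. *)
pose S := [set t | T <= t /\ (phi theta' t <= l \/ T + T0 <= t)].
have S1 : S (T + T0) by split; [rewrite lerDl|right].
have lS : has_lbound S by exists T => t [].
have TS : T <= inf S by apply: lb_le_inf; [exists (T + T0)|move=> t []].
have S_T0 : inf S <= T + T0 by exact: ge_inf.
have [_ Sinf] : S (inf S).
  apply: inf_attained => //; first by exists (T + T0).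
  move=> t tS nS; have [tT|Tt] := ltP t T.
    exists (T - t); first by rewrite subr_gt0.
    by move=> s _; rewrite addrC subrK => sT [/le_lt_trans/(_ sT)]; rewrite ltxx.
  have t0 := le_trans T_ge0 Tt.
  have lp : 0 < phi theta' t - l.
    by rewrite subr_gt0 ltNge; apply/negP => ?; apply: nS; split => //; left.
  have tTT : t < T + T0 by rewrite ltNge; apply/negP => ?; apply: nS; split => //; right.
  have [d d0 Hd] := dynamics_right y x pp cr t0 lp.
  exists (Num.min d (T + T0 - t)); first by rewrite lt_min d0 subr_gt0.
  move=> s ts; rewrite -ltrBlDl lt_min => /andP[sd sT] [_ []].
    have := Hd s (ltW ts); rewrite -ltrBlDl => /(_ sd); rewrite ltr_norml; lra.
  lra.
have above t : T <= t -> t < inf S -> l < phi theta' t.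
  move=> Tt tS; rewrite ltNge; apply/negP => tl.
  by have := ge_inf lS (conj Tt (or_introl tl) : S t); rewrite leNgt tS.
have nz' t : 0 <= t -> t < inf S -> phi theta' t != 0.
  move=> t0 tS; have [tT|Tt] := ltP t T.
    by rewrite /theta' (extend_phi p T_ge0 lt t0 (ltW tT)); exact: nz.
  by rewrite gt_eqF// (le_lt_trans l0)// above.
have S0 := le_trans T_ge0 TS.
have a'D := split_admissible lt' S0 nz'.
have rE : phi theta' (inf S) = a + (y + p / (2 * c)) * (inf S - T) -
    (rho theta' (inf S) - rho theta T).
  have := dynamics_split theta T; rewrite phiT => ->.
  have thS : theta' (inf S) = theta T + p * (inf S - T).
    rewrite /theta' /extend; case: ifP => // ST.
    by rewrite (_ : inf S = T) ?subrr ?mulr0 ?addr0//; apply/eqP; rewrite eq_le ST TS.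
  by rewrite dynamics_split thS; field; rewrite gt_eqF.
have rhoT : rho theta' T = rho theta T by exact: extend_rho.
have drho : 0 <= rho theta' (inf S) - rho theta T.
  by rewrite subr_ge0 -rhoT; case: cr => _ + _ _; apply.
exists (phi theta' (inf S)), (inf S - T); split => //.
- by rewrite subr_ge0 TS/=; lra.
- by case: Sinf => [|hs]; [left|right; lra].
- by rewrite rE gerBl.
have [me' le_E'] := extend_energy p T_ge0 TS me le_E.
have GE' := extend_running_cost (p := p) T_ge0 TS (hext_ge0 gd l) lt GE
  (fun t Tt tS => hext_homo gd (ltW (above t Tt tS))).
exists theta', (inf S), (G + hext l * (inf S - T)),
  (E + p ^+ 2 / (4 * c) * (inf S - T)).
split; split => //.
(* A unit of control earns [r], while the drop of the state that it causes is credited only [p]; the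
   surplus is given away. *)
have : 0 <= (r - p) * (rho theta' (inf S) - rho theta T).
  by rewrite mulr_ge0// subr_ge0.
have HE : H p * (inf S - T) + p ^+ 2 / (4 * c) * (inf S - T) = - (p * y) * (inf S - T).
  by rewrite /hamiltonian; field; rewrite gt_eqF.
have vE : p * ((y + p / (2 * c)) * (inf S - T)) =
    p * y * (inf S - T) + 2 * (p ^+ 2 / (4 * c) * (inf S - T)).
  by field; rewrite gt_eqF.
move: JE HE vE; rewrite rE -/c.
move: (y + p / (2 * c)) (p ^+ 2 / (4 * c)) (inf S - T) (rho theta' (inf S)) (rho theta T).
move=> v k s r1 r0; lra.
Qed.

(** At time 0 only a jump of the control can have occurred, and it is paid [r] per unit. *)
Lemma reached_start : exists a, [/\ 0 <= a <= D, a <= x & reached a (r * (x - a))].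
Proof.
pose theta0 : R -> R := cst 0.
have lt : lipschitz_path theta0.
  by split => //; exists 0 => s t; rewrite subrr normr0 mul0r.
have phi0 : phi theta0 0 = x - rho theta0 0.
  by rewrite dynamics_split /theta0/= mul0r mulr0 !addr0.
have nz s : 0 <= s -> s < 0 -> phi theta0 s != 0.
  by move=> s0 /(le_lt_trans s0); rewrite ltxx.
exists (phi theta0 0); split; first exact: split_admissible.
  by rewrite phi0 gerBl; have [+ _ _ _] := split_control lt; apply.
exists theta0, 0, 0, 0; split; split => //.
- by rewrite set_itv_ge ?bnd_simp ?ltxx//; exact: measurable_fun_set0.
- by rewrite set_itv_ge ?bnd_simp ?ltxx// integral_set0.
- by rewrite set_itv1 integral_set1.
- by rewrite phi0; lra.
Qed.

Lemma reached_cost J : reached 0 J ->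
  (J%:E <= ereal_sup [set cost r c1 c2 y h x psi (alpha psi)
                     | psi in finite_hitting y x alpha])%E.
Proof.
move=> [theta [T [G [E [[T0 lt [nz phiT]] [me le_E GE JE]]]]]].
have pp := lipschitz_path2 lt.
have tau : hitting_time y x (split_path theta) (rho theta) = T%:E.
  apply/eqP; rewrite eq_le; apply/andP; split; first exact: hitting_time_le.
  exact: le_hitting_time.
apply: (@le_trans _ _ (cost r c1 c2 y h x (split_path theta) (rho theta))); last first.
  apply: ereal_sup_ubound; exists (split_path theta) => //; split => //.
  by rewrite tau ltry.
have hE : (\int[mu]_(t in `[0%R, T]) (h (phi theta t))%:E =
    \int[mu]_(t in `[0%R, T]) (hext (phi theta t))%:E)%E.
  apply: eq_integral => t; rewrite inE/= in_itv/= => /andP[t0 tT].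
  rewrite hextE//; apply: split_admissible => // s s0 st.
  exact: nz (lt_le_trans st tT).
rewrite /cost tau /= hE /energy asboolT; last first.
  have [_ [K HK]] := lt.
  have HK' k s t : `|theta t * k - theta s * k| <= `|k| * K * `|t - s|.
    by rewrite -mulrBl normrM mulrC -mulrA ler_wpM2l.
  split; first exact: lipschitz_abs_continuous (HK' _).
  apply: (lipschitz_abs_continuous (K := `|- (2 * c2)^-1| * K)) => s t.
  rewrite /= (_ : _ - _ = theta t * - (2 * c2)^-1 - theta s * - (2 * c2)^-1).
    exact: HK'.
  by ring.
have eE : (\int[mu]_(t in `[0%R, T]) (energy_rate theta t)%:E <= E%:E)%E.
  rewrite -integral_itv_obnd_cbnd; last first.
    by apply/measurable_EFinP/measurable_fun_itv_bndo_bndcP.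
  by rewrite -integral_itv_bndo_bndc//; exact/measurable_EFinP.
apply: (@le_trans _ _ (G%:E + (r * rho theta T)%:E - E%:E)%E).
  by rewrite -!EFinD lee_fin.
by apply: leeB => //; exact: leeD.
Qed.

End steering.

(** * The payoff that the maximizer can secure *)

Section lower_bound.
Context {R : realType}.
Variables (D r c y : R) (h : R -> R).
Hypothesis gd : bellman_data D r c y h.
Let hD : 0 < D. Proof. by case: gd => -[]. Qed.
Let hr : 0 < r. Proof. by case: gd => -[]. Qed.
Let hc : 0 < c. Proof. by case: gd => -[]. Qed.
Local Notation H := (hamiltonian c y).
Local Notation slope := (slope D r c y h).
Local Notation hext := (hext D h).

Variable V : R -> R.
Hypothesis V0 : V 0 = 0.
Hypothesis V_slope : forall s t, 0 <= s -> s <= t -> t <= D ->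
  slope s * (t - s) <= V t - V s <= slope t * (t - s).

Variable xs : R.
Hypothesis xs_itv : 0 <= xs <= D.
Hypothesis xs_low : forall x, x <= xs -> hext x <= H r.
Hypothesis xs_high : forall x, xs < x -> x <= D -> H r < hext x.

(** An abstract form of [reached]; [reach_steer] is what [steer] provides. *)
Variable reach : R -> R -> Prop.
Hypothesis reach_steer : forall a J p l T0, reach a J ->
  0 <= p -> p <= r -> 0 <= l -> 0 <= T0 ->
  exists a' s, [/\ 0 <= a' <= D, 0 <= s <= T0, a' <= l \/ s = T0,
    a' <= a + (y + p / (2 * c)) * s &
    reach a' (J + p * (a - a') + (hext l - H p) * s)].

(** Below the vertex the drift is [- v < 0], so the state is at most [l] after time [(a - l) / v] at
    the latest, and the condition on [H p] makes waiting free of loss. *)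
Lemma descend a J p l : reach a J -> 0 <= p -> p <= r -> p < - (2 * c * y) ->
  0 <= l -> H p <= hext l ->
  exists a' J', [/\ 0 <= a' <= D, a' <= l, reach a' J' & J + p * (a - a') <= J'].
Proof.
move=> aJ p0 pr py l0 Hp; pose v := - (y + p / (2 * c)).
have v0 : 0 < v.
  rewrite /v oppr_gt0 addrC -ltrBrDr sub0r ltr_pdivrMr ?mulr_gt0//.
  by move: py; rewrite mulNr; lra.
have T00 : 0 <= pos_part (a - l) / v.
  by apply: divr_ge0; [have [] := pos_part_bounds (a - l) 0|exact: ltW].
have [a' [s [a'D /andP[s0 sT] stop a'v Ra']]] := reach_steer aJ p0 pr l0 T00.
exists a', (J + p * (a - a') + (hext l - H p) * s); split => //; last first.
  by rewrite lerDl mulr_ge0// subr_ge0.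
case: stop => // sE; apply: le_trans a'v _.
rewrite -(opprK (y + _)) -/v mulNr sE mulrC divfK ?gt_eqF//.
by rewrite /pos_part /Num.max; case: ltP; lra.
Qed.

(** Real induction on the level. Where the slope oscillates by at most [e], the momentum [slope s]
    earns the increment of [V] up to [e] per unit of descent, in total [e * a]. *)
Lemma low_guarantee e : 0 < e -> forall a J, 0 <= a <= xs -> reach a J ->
  exists J', reach 0 J' /\ J + V a - e * a <= J'.
Proof.
move=> e0; have [xs0 xsD] := andP xs_itv.
suff W : forall a J, 0 <= a -> a <= xs -> reach a J ->
    exists J', reach 0 J' /\ J + V a - e * a <= J'.
  by move=> a J /andP[a0 ax]; exact: W.
pose P m := forall a J, 0 <= a -> a <= m -> reach a J ->
  exists J', reach 0 J' /\ J + V a - e * a <= J'.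
apply: (@real_induction _ 0 xs P) => //.
  move=> a J a0 a0'; have -> : a = 0 by apply/eqP; rewrite eq_le a0 a0'.
  by move=> RJ; exists J; rewrite V0 mulr0 subr0 addr0.
move=> x /andP[x0 xxs].
have [d d0 Hd] := slope_small_oscillation gd (xs_low (lexx xs)) e0 xxs.
exists d => // s t s0 xds sx xt txd txs Ps a J a0 at_ aJ.
have [as_|sa] := leP a s; first exact: Ps.
(* Strictly below [xs] the slope is strictly below the vertex, as [descend] requires. *)
have sxs : s < xs by apply: lt_le_trans sa (le_trans at_ txs).
have sr : hext s < H r.
  apply: lt_le_trans (xs_low (lexx xs)).
  rewrite !hextE ?xs0 ?xsD ?s0 ?(le_trans (ltW sxs))//.
  by case: gd => _ [_ + _ _]; apply.
have [a' [J' [/andP[a'0 _] a's Ra' JJ']]] : exists a' J', [/\ 0 <= a' <= D, a' <= s, reach a' J' &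
    J + slope s * (a - a') <= J'].
  apply: descend => //.
  - exact: slope_ge0 gd _.
  - exact: slope_ler gd _.
  - exact: slope_low_lt_vertex.
  - exact: hamiltonian_slope gd _.
have [J'' [R0 JJ'']] := Ps a' J' a'0 a's Ra'.
exists J''; split => //; apply: le_trans JJ''.
have a'a : a' <= a by apply: le_trans a's (ltW sa).
have /andP[_ Va] := V_slope a'0 a'a (le_trans at_ (le_trans txs xsD)).
have osc : slope a - slope s <= e.
  by apply: Hd => //; [exact: ltW|exact: le_lt_trans at_ txd|exact: le_trans at_ txs].
have aa0 : 0 <= a - a' by rewrite subr_ge0.
have := ler_wpM2r aa0 osc; rewrite mulrBl mulrBr; lra.
Qed.

Lemma switch_hamiltonian : xs < D -> hext xs = H r.
Proof.
move=> xsD; apply/eqP; rewrite eq_le xs_low//= leNgt; apply/negP => lt.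
have /cvgr_lt/(_ _ lt)/nbhs_ballP[d /= d0 Hd] := @hext_continuous _ _ _ _ _ _ gd xs.
pose k := Num.min (D - xs) d.
have k0 : 0 < k by rewrite lt_min subr_gt0 xsD.
have [k1 k2] : k <= D - xs /\ k <= d by rewrite !ge_min !lexx orbT.
have : H r < hext (xs + k / 2) by apply: xs_high; lra.
rewrite ltNge => /negP; apply; apply/ltW/Hd.
rewrite /ball/= opprD addrA subrr sub0r normrN ger0_norm; lra.
Qed.

(** The loss [e] is split into thirds: the descent below [xs], the overshoot of [l] above [xs], and
    a momentum slightly below [slope xs]. *)
Lemma guarantee e a J : 0 < e -> 0 <= a <= D -> reach a J ->
  exists J', reach 0 J' /\ J + V a - e <= J'.
Proof.
move=> e0 /andP[a0 aD] aJ; have [xs0 xsD] := andP xs_itv.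
have vy : 0 < - (2 * c * y).
  have := y_lt0 gd; rewrite -oppr_gt0 => y0.
  by rewrite -mulrN mulr_gt0// mulr_gt0.
pose e' := e / (3 * D).
have e'0 : 0 < e' by rewrite divr_gt0// mulr_gt0.
have e'D : e' * D = e / 3 by rewrite /e'; field; rewrite gt_eqF.
have low b J1 : 0 <= b -> b <= xs -> reach b J1 ->
    exists J', reach 0 J' /\ J1 + V b - e / 3 <= J'.
  move=> b0 bxs bJ; have [|J' [R0 JJ']] := low_guarantee e'0 _ bJ; first by rewrite b0.
  exists J'; split => //; apply: le_trans JJ'; rewrite lerD2l lerN2 -e'D ler_wpM2l ?(ltW e'0)//.
  exact: le_trans bxs xsD.
have [axs|xsa] := leP a xs.
  have [J' [R0 JJ']] := low a J a0 axs aJ.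
  by exists J'; split => //; lra.
have xsD' : xs < D by exact: lt_le_trans xsa aD.
have Hxs := switch_hamiltonian xsD'.
(* At [xs] the slope may equal the vertex, where the drift vanishes; lowering it by [e'] restores a
   negative drift. *)
pose p := Num.max 0 (slope xs - e').
have p0 : 0 <= p by rewrite le_max lexx.
have ps : slope xs - e' <= p by rewrite le_max lexx orbT.
have sx := slope_ge0 gd xs.
have ps' : p <= slope xs by rewrite ge_max sx/=; lra.
have py : p < - (2 * c * y).
  by rewrite gt_max vy/=; have := slope_low_vertex (xs_low (lexx xs)); lra.
have Hp : H p <= hext xs.
  rewrite -(hamiltonian_slope_low gd (xs_low (lexx xs))).
  by apply: (hamiltonian_homo gd) => //; exact: slope_low_vertex (xs_low (lexx xs)).
pose l := Num.min (xs + e / (3 * r)) D.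
have er0 : 0 < e / (3 * r) by rewrite divr_gt0// mulr_gt0.
have xsl : xs < l by rewrite lt_min xsD' ltrDl er0.
have lD : l <= D by rewrite ge_min lexx orbT.
have l_xs : r * (l - xs) <= e / 3.
  rewrite (_ : e / 3 = r * (e / (3 * r))); last by field; rewrite gt_eqF.
  by rewrite ler_wpM2l ?(ltW hr)// lerBlDl ge_min lexx.
have k0 : 0 < hext l - H r by rewrite subr_gt0; exact: xs_high.
have l0 : 0 <= l by apply: le_trans xs0 (ltW xsl).
(* In this time the rate [hext l - H r] earns [r * D], which is at least [V a]. *)
have T00 : 0 <= r * D / (hext l - H r) by rewrite divr_ge0 ?mulr_ge0 ?ltW.
have [a' [s [/andP[a'0 a'D] /andP[s0 _] stop _ Ra']]] := reach_steer aJ (ltW hr) (lexx r) l0 T00.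
set J1 := J + r * (a - a') + (hext l - H r) * s in Ra'.
have Va : V a - V xs <= r * (a - xs).
  have /andP[_ h2] := V_slope xs0 (ltW xsa) aD.
  apply: le_trans h2 _; rewrite ler_wpM2r ?subr_ge0 ?(ltW xsa)//.
  exact: slope_ler gd _.
have ks : 0 <= (hext l - H r) * s by rewrite mulr_ge0// ltW.
(* When the time has run out the maximizer gives up: with momentum 0 the negative drift [y] carries
   the state to 0 without energy. *)
case: stop => [a'l|sE]; last first.
  have H0 : H 0 <= hext 0 by rewrite /hamiltonian expr0n/= !mulr0 subr0; exact: hext_ge0 gd _.
  have [a2 [J2 [/andP[a20 _] a2l R2 JJ2]]] := descend Ra' (lexx 0) (ltW hr) vy (lexx 0) H0.
  have a2E : a2 = 0 by apply/eqP; rewrite eq_le a2l a20.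
  exists J2; split; first by rewrite -a2E.
  have kE : (hext l - H r) * s = r * D by rewrite sE mulrC divfK ?gt_eqF.
  apply: le_trans JJ2; rewrite mul0r addr0 /J1 kE.
  have /andP[_ h2] := V_slope (lexx 0) a0 aD; rewrite V0 !subr0 in h2.
  have := ler_wpM2r a0 (slope_ler gd a).
  have : 0 <= r * (D - a') by rewrite mulr_ge0 ?subr_ge0// ltW.
  rewrite mulrBr mulrBr; lra.
have [a'xs|xsa'] := leP a' xs.
  have [J' [R0 JJ']] := low a' J1 a'0 a'xs Ra'.
  exists J'; split => //; apply: le_trans JJ'.
  have /andP[_ h2] := V_slope a'0 a'xs xsD.
  have xa : 0 <= xs - a' by rewrite subr_ge0.
  have := ler_wpM2r xa (slope_ler gd xs).
  by rewrite /J1; move: Va h2 ks; rewrite !mulrBr; lra.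
(* The state stopped between [xs] and [l]; momentum [p] completes the descent to [xs] or below. *)
have [a2 [J2 [/andP[a20 _] a2xs R2 JJ2]]] :=
  descend Ra' p0 (le_trans ps' (slope_ler gd _)) py xs0 Hp.
have [J' [R0 JJ']] := low a2 J2 a20 a2xs R2.
exists J'; split => //; apply: le_trans JJ'.
have /andP[_ h2] := V_slope a20 a2xs xsD.
have xa : 0 <= xs - a2 by rewrite subr_ge0.
have h3 : slope xs * (xs - a2) <= p * (xs - a2) + e / 3.
  have := ler_wpM2r xa ps; rewrite mulrBl.
  have : e' * (xs - a2) <= e / 3 by rewrite -e'D ler_wpM2l ?(ltW e'0)//; lra.
  lra.
have h4 : 0 <= p * (a' - xs) by rewrite mulr_ge0 ?subr_ge0 ?(ltW xsa').
have h5 : r * (a' - xs) <= r * (l - xs) by rewrite ler_wpM2l ?(ltW hr)// lerD2r.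
move: JJ2; rewrite /J1; move: Va h3 h4 h5 l_xs ks h2; rewrite !mulrBr; lra.
Qed.

End lower_bound.

(** * The value of the game *)

Section value.
Context {R : realType}.
Variables (D r c1 c2 y : R) (h : R -> R).
Hypotheses (hc1 : 0 < c1) (hc2 : 0 < c2).
Hypothesis gd : bellman_data D r (c1^-1 + c2^-1)^-1 y h.

(** Reflection at [xs] gives the upper bound. Against any strategy, an initial jump from [x] to [a]
    is paid [r * (x - a)], at least [V x - V a], and [guarantee] supplies [V a] up to [e]. *)
Lemma game_valueE x : 0 <= x <= D -> game_value D r c1 c2 y h x =
  (slope_primitive D r (c1^-1 + c2^-1)^-1 y h x)%:E.
Proof.
move=> x0D; set V := slope_primitive _ _ _ _ _.
have V_slope s t : 0 <= s -> s <= t -> t <= D ->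
    slope D r (c1^-1 + c2^-1)^-1 y h s * (t - s) <= V t - V s <=
    slope D r (c1^-1 + c2^-1)^-1 y h t * (t - s).
  by move=> s0 st _; exact: slope_primitive_bounds.
have V0 : V 0 = 0 by exact: slope_primitive0.
have [xs [xs_itv _ low high]] := switch_level gd.
apply/eqP; rewrite eq_le; apply/andP; split.
  apply: ge_ereal_inf; exists (ereal_sup [set cost r c1 c2 y h x psi (reflect y xs x psi)
      | psi in finite_hitting y x (reflect y xs x)]).
    by exists (reflect y xs x) => //; exact: reflect_admissible.
  apply: ge_ereal_sup => _ [psi fin <-].
  exact: (reflect_cost hc1 hc2 gd V0 V_slope xs_itv low high).
apply: le_ereal_inf_tmp => _ [alpha adm <-]; apply/lee_addgt0Pr => e e0.
have [a [a0D ax Ra]] := reached_start r h hc1 hc2 adm.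
have [J' [R0 JJ']] := guarantee gd V0 V_slope xs_itv low high
  (steer hc1 hc2 gd adm) e0 a0D Ra.
apply: le_trans (leeD (reached_cost adm R0) (lexx e%:E)).
rewrite -EFinD lee_fin.
have [/andP[a0 aD] /andP[_ xD]] := (a0D, x0D).
have /andP[_ Vx] := V_slope a x a0 ax xD.
have xa : 0 <= x - a by rewrite subr_ge0.
by have := ler_wpM2r xa (slope_ler gd x); lra.
Qed.

End value.

Theorem theorem3p1 (R : realType) (D r c1 c2 c y : R) (h : R -> R)
    (hD : 0 < D) (hr : 0 < r) (hc1 : 0 < c1) (hc2 : 0 < c2)
    (hc : c = (c1^-1 + c2^-1)^-1)
    (h_cont : {within `[0, D], continuous h})
    (h_incr : forall u v : R, 0 <= u -> u < v -> v <= D -> h u < h v)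
    (h_ge0 : forall u : R, 0 <= u <= D -> 0 <= h u)
    (h_0 : h 0 = 0)
    (hy : r / (4 * c) <= - y) :
  [/\ forall x : R, 0 <= x <= D -> game_value D r c1 c2 y h x \is a fin_num,
      viscosity_solution D r c y h (fun x => fine (game_value D r c1 c2 y h x))
    & forall f : R -> R, viscosity_solution D r c y h f ->
        forall x : R, 0 <= x <= D -> f x = fine (game_value D r c1 c2 y h x)].
Proof.
subst c; have gd : bellman_data D r (c1^-1 + c2^-1)^-1 y h.
  by split; split => //; rewrite invr_gt0 addr_gt0 ?invr_gt0.
have UE := game_valueE hc1 hc2 gd.
(* With these chord bounds the viscosity results apply to the value of the game directly. *)
have V_slope s t : 0 <= s -> s <= t -> t <= D ->
    slope D r (c1^-1 + c2^-1)^-1 y h s * (t - s) <=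
    fine (game_value D r c1 c2 y h t) - fine (game_value D r c1 c2 y h s) <=
    slope D r (c1^-1 + c2^-1)^-1 y h t * (t - s).
  move=> s0 st tD; rewrite !UE ?s0 ?tD ?(le_trans s0) ?(le_trans st)//=.
  exact: slope_primitive_bounds.
have V0 : fine (game_value D r c1 c2 y h 0) = 0.
  by rewrite UE ?lexx ?ltW//= slope_primitive0.
split=> [x x0D||f fsol x x0D].
- by rewrite UE.
- exact: (value_viscosity_solution gd V0 V_slope).
- exact: (viscosity_solution_unique gd V0 V_slope fsol).
Qed.
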